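(* There exists an absolute constant $C\ge1$ such that the following holds. Let $N\ge1$ and $n\in[N]$ be integers, $0<\delta\le1$, $0<\varepsilon\le1$, and let $k\in[N]$ be such that $k\ln(eN/k)\ge n$. Let $T$ be a non-empty subset of $\mathbb{R}^n$ and denote $M:=N(T,\varepsilon B_\infty^n)$. Then there exist a set $\mathcal{N}\subset T$ and a collection $\mathcal{P}$ of parallelepipeds in $\mathbb{R}^n$ such that $$\max\{|\mathcal{N}|,|\mathcal{P}|\}\le M\,F(\delta,n,N)\,e^{\delta N},$$ and such that, moreover, for any $N\times n$ random matrix $\Gamma=\{\xi_{ij}\}$ whose entries are independent symmetric real random variables with $\mathbb{E}\xi_{ij}^2=1$ and such that in each row the entries are identically distributed, with probability at least $1-e^{-k\ln(eN/k)}-e^{-\delta N/4}$ both of the following hold: (1) for every $x\in T$ there exists $y\in\mathcal{N}$ such that $\displaystyle\|\Gamma(x-y)\|_{k,2}\le C\varepsilon\sqrt{\frac{kn}{\delta}\ln\left(\frac{eN}{k}\right)}$; (2) for every $x\in T$ there exists $P\in\mathcal{P}$ such that $x\in P$ and $\displaystyle\Gamma P\subset\Gamma x+C\varepsilon\sqrt{\frac{kn}{\delta}\ln\left(\frac{eN}{k}\right)}\ \mathbf{B}_{k,2}$.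
   Context: $[N]=\{1,\dots,N\}$. $B_\infty^n$ is the unit ball of $\ell_\infty^n$. For $a\in\mathbb{R}^N$ let $a_1^*\ge\dots\ge a_N^*$ be the decreasing rearrangement of $|a_1|,\dots,|a_N|$, and for $1\le k\le N$ set $\|a\|_{k,2}=\left(\sum_{i=1}^k(a_i^* )^2\right)^{1/2}$; $\mathbf{B}_{k,2}\subset\mathbb{R}^N$ is the unit ball of this norm. For a set $L\subset\mathbb{R}^m$, a convex body $K\subset\mathbb{R}^m$ and $\varepsilon>0$, an $\varepsilon$-net of $L$ with respect to $K$ is a set $\mathcal{N}$ with $\mathcal{N}\subset L\subset\bigcup_{x\in\mathcal{N}}(x+\varepsilon K)$; $N(L,\varepsilon K)$ is the cardinality of the smallest such net. $|E|$ denotes the cardinality of a set $E$. $F(\delta,n,N)=(32\delta N/n)^n$ if $\delta\ge n/(2N)$, and $F(\delta,n,N)=\left(en/(\delta N)\right)^{4\delta N}$ if $\delta<n/(2N)$. *)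

(* Defs.v *)
From HB Require Import structures.
From mathcomp Require Import all_boot all_order all_algebra.
From mathcomp Require Import all_classical all_reals all_analysis.

Set Implicit Arguments.
Unset Strict Implicit.
Unset Printing Implicit Defensive.

Import Order.TTheory GRing.Theory Num.Theory.
Import numFieldNormedType.Exports.

Local Open Scope classical_set_scope.
Local Open Scope ring_scope.

(* The vectors of R^n are the column vectors 'cV[R]_n. *)

(* The norm of MathComp-Analysis on matrices is the maximum of the absolute
   values of the entries. *)
Definition Binf (R : realType) (n : nat) : set 'cV[R]_n :=
  [set x | `|x| <= 1].

(* a^*_{i+1} is the entry of index i of this sequence. *)
Definition rearrangement (R : realType) (N : nat) (a : 'cV[R]_N) : seq R :=
  sort (fun x y : R => y <= x) [seq `|a i 0| | i : 'I_N].

Definition norm_k2 (R : realType) (N k : nat) (a : 'cV[R]_N) : R :=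
  Num.sqrt (\sum_(i < k) (rearrangement a)`_i ^+ 2).

Definition Bk2 (R : realType) (N k : nat) : set 'cV[R]_N :=
  [set a | norm_k2 k a <= 1].

Definition is_net (R : realType) (m : nat) (L K : set 'cV[R]_m) (eps : R)
    (A : set 'cV[R]_m) : Prop :=
  A `<=` L /\ L `<=` \bigcup_(x in A) [set x + eps *: u | u in K].

(* [counting] is the number of elements, +oo for an infinite set; so the
   covering number is +oo when there is no finite net, and otherwise the
   infimum is attained. *)
Definition covering_number (R : realType) (m : nat) (L K : set 'cV[R]_m)
    (eps : R) : \bar R :=
  ereal_inf [set counting A | A in is_net L K eps].

Definition parallelepiped (R : realType) (n : nat) (Q : set 'cV[R]_n) : Prop :=
  exists (a : 'cV[R]_n) (V : 'M[R]_n), V \in unitmx /\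
    Q = [set a + V *m t | t in [set t : 'cV[R]_n | forall i, 0 <= t i 0 <= 1]].

Definition F (R : realType) (delta : R) (n N : nat) : R :=
  if n%:R / (2 * N%:R) <= delta then (32 * delta * N%:R / n%:R) ^+ n
  else (expR 1 * n%:R / (delta * N%:R)) `^ (4 * delta * N%:R).

Section RandomVariables.
Context d (Omega : measurableType d) (R : realType) (P : probability Omega R).

Definition same_law (X Y : Omega -> R) : Prop :=
  forall B : set R, measurable B -> P (X @^-1` B) = P (Y @^-1` B).

Definition symmetric_rv (X : Omega -> R) : Prop :=
  same_law X (fun w => - X w).

Definition independent_rvs (I : finType) (X : I -> Omega -> R) : Prop :=
  forall (J : {set I}) (B : I -> set R),
    (forall i, i \in J -> measurable (B i)) ->
    P (\bigcap_(i in [set` J]) (X i @^-1` B i)) =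
    (\prod_(i in J) P (X i @^-1` B i))%E.

End RandomVariables.

Definition random_matrix (Omega : Type) (R : realType) (N n : nat)
    (xi : 'I_N -> 'I_n -> Omega -> R) (w : Omega) : 'M[R]_(N, n) :=
  \matrix_(i, j) xi i j w.

(* Main.v *)
(* For l in N^n let D_l be the diagonal matrix with entries 4^-l_j.  If the rows
   of Gamma D_l have squared length at most S = 256 n / delta then, given the
   absolute values of the entries, the random signs make the coordinates of
   Gamma D_l v subgaussian with variance at most S for every v in {-1,1}^n, and
   a union bound over v together with convexity controls Gamma D_l on the whole
   cube.  Such an l with 4^|l| <= exp (delta N / 2) exists with probability at
   least 1 - exp (- delta N / 4): choose l for each row by water filling and add
   up; the expectation of 4^|l| for one row is at most exp (delta / 4), and the
   rows are independent.  Being admissible depends only on the absolute values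
   of the entries, so the two steps combine.  Finally the cubes of an optimal
   net of T are cut into translates of 2 eps D_l [0,1]^n for every l with
   4^|l| <= exp (delta N / 2); each l costs 4^|l| translates, and these numbers
   sum to at most F(delta,n,N) exp (delta N). *)

Require Import Defs.
From HB Require Import structures.
From mathcomp Require Import all_boot all_order all_algebra.
From mathcomp Require Import all_classical all_reals all_analysis.
From mathcomp Require Import measurable_realfun.
From mathcomp Require Import ring lra.

Set Implicit Arguments.
Unset Strict Implicit.
Unset Printing Implicit Defensive.

Import Order.TTheory GRing.Theory Num.Theory.
Import numFieldNormedType.Exports.

Local Open Scope classical_set_scope.
Local Open Scope ring_scope.

(** * Scaling the columns for one row *)

(** Convexity of the exponential. The chord makes the Markov factors of a row linear in each squared
    entry, so that second moments suffice to integrate them. *)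
Lemma expR_chord (R : realType) (h z : R) : 0 <= z <= 1 ->
  expR (h * z) <= 1 + z * (expR h - 1).
Proof.
move=> z01.
have [z0 z1] := andP z01.
have := @convex_expR R (Itv01 z0 z1) h 0.
rewrite !convRE /= expR0 mulr0 addr0 [z * h]mulrC => /le_trans; apply.
by rewrite /unstable.onem; lra.
Qed.

(** Take the least [m] with [b <= w * 16 ^+ m]. If [m > 0], minimality gives [16 ^+ m.-1 < b / w];
    weakening 16 to 4 is wasteful but leaves a cost linear in [b]. The base is 16 because dividing
    an entry by 4 divides its square by 16. *)
Lemma scale_level (R : realType) (b w : R) : 0 <= b -> 0 < w ->
  exists m : nat, [/\ b / 16 ^+ m <= w, b <= w -> m = 0%N
    & w < b -> 4 ^+ m <= 4 * (b / w)].
Proof.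
move=> b0 w0.
have ex : exists m : nat, b <= w * 16 ^+ m.
  exists (Num.bound (b / w)); rewrite mulrC -ler_pdivrMr//.
  apply: le_trans (ltW (archi_boundP (divr_ge0 b0 (ltW w0)))) _.
  by rewrite -natrX ler_nat ltnW// ltn_expl.
case: (ex_minnP ex) => m bm minm; exists m; split.
- by rewrite ler_pdivrMr// exprn_gt0.
- move=> bw; apply/eqP; rewrite -leqn0; apply: minm.
  by rewrite expr0 mulr1.
- case: m bm minm => [|m] _ minm wb.
    by rewrite expr0 (@le_trans _ _ (4 * 1))// ?ler_pM2l// ?ler_pdivlMr ?mul1r ?ltW//; lra.
  have : w * 16 ^+ m < b.
    by rewrite ltNge; apply/negP => /minm; rewrite ltnn.
  rewrite mulrC -ltr_pdivlMr// => /ltW lb.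
  rewrite exprS ler_pM2l//; apply: le_trans lb.
  by rewrite lerXn2r ?nnegrE//; lra.
Qed.

(* Water filling: the entries above the level 2^-(s+1), for the least s at
   which the truncated sum is at most 1, are brought down to that level.  The
   s-th term on the right is an exponential Markov bound for the event that the
   truncated sum at level 2^-s is still at least 1. *)
Lemma row_scaling (R : realType) (h : R) (n : nat) (b : 'I_n -> R) :
  0 <= h -> (forall j, 0 <= b j) ->
  exists l : 'I_n -> nat, \sum_j b j / 16 ^+ l j <= 1 /\
    4 ^+ (\sum_j l j) <=
      1 + \sum_(s < n) expR (- (h * 2 ^+ s))
                       * \prod_j (1 + 8 * expR h * 2 ^+ s * b j).
Proof.
move=> h0 b0.
have T0 s : 0 <= expR (- (h * 2 ^+ s)) * \prod_j (1 + 8 * expR h * 2 ^+ s * b j).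
  rewrite mulr_ge0 ?expR_ge0//; apply: prodr_ge0 => j _.
  by rewrite addr_ge0// !mulr_ge0 ?expR_ge0 ?exprn_ge0.
have [b1|b1] := leP (\sum_j b j) 1.
  exists (fun=> 0%N); split.
    by under eq_bigr do rewrite expr0 divr1.
  by rewrite big1// expr0 lerDl sumr_ge0.
pose P s := \sum_j Num.min (b j) (2 ^- s.+1) <= 1.
have n0 : (0 < n)%N.
  case: n b b0 T0 b1 @P => // b _ _ b1 _.
  by move: b1; rewrite big_ord0 ltNge ler01.
(* At level [2 ^- n] the truncated sum is at most [n / 2 ^+ n <= 1], so the least [s] is below
   [n]. *)
have Pn : P n.-1.
  rewrite /P prednK// (@le_trans _ _ (\sum_(j < n) 2 ^- n))//.
    by apply: ler_sum => j _; rewrite ge_min lexx orbT.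
  rewrite sumr_const card_ord -[X in X *+ _]mul1r -mulrnAl ler_pdivrMr ?exprn_gt0//.
  by rewrite mul1r -natrX ler_nat ltnW// ltn_expl.
case: (ex_minnP (ex_intro (fun m => P m) _ Pn)) => s Ps mins.
have sn : (s < n)%N by rewrite -(prednK n0) ltnS mins.
(* Minimality of [s]; for [s = 0] it follows from the sum of the [b j] exceeding 1. *)
have ge1 : 1 <= \sum_j Num.min (b j) (2 ^- s).
  case: s Ps mins {sn} => [_ _|s _ mins]; last first.
    by rewrite leNgt; apply/negP => /ltW /mins; rewrite ltnn.
  rewrite expr0 invr1; have [[j bj]|bj] := pselect (exists j, 1 < b j).
    rewrite (bigD1 j)//= min_r ?(ltW bj)// lerDl sumr_ge0//.
    by move=> i _; rewrite le_min b0 ler01.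
  apply: le_trans (ltW b1) _; apply: ler_sum => j _.
  by rewrite le_min lexx/= leNgt; apply/negP => bj'; apply: bj; exists j.
have w0 : 0 < 2 ^- s.+1 :> R by rewrite invr_gt0 exprn_gt0.
have u0 : 0 < 2 ^+ s :> R by rewrite exprn_gt0.
have /choice[l lP] := fun j => scale_level (b0 j) w0.
exists l; split.
  apply: le_trans Ps; apply: ler_sum => j _; rewrite le_min; case: (lP j) => -> _ _.
  by rewrite andbT ler_pdivrMr ?exprn_gt0// ler_peMr// exprn_ege1//; lra.
apply: (@le_trans _ _ (expR (- (h * 2 ^+ s))
                       * \prod_j (1 + 8 * expR h * 2 ^+ s * b j))); last first.
  rewrite [X in _ <= _ + X](bigD1 (Ordinal sn))//= addrCA lerDl addr_ge0// sumr_ge0//.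
rewrite expRN ler_pdivlMl ?expR_gt0//.
(* By [ge1], [2 ^+ s] is at most the sum of the minima of [2 ^+ s * b j] and 1; this reduces the
   claim to one factor per coordinate. *)
apply: (@le_trans _ _ (\prod_j (expR (h * Num.min (2 ^+ s * b j) 1) * 4 ^+ l j))).
  rewrite big_split/= prodrXr ler_pM2r ?exprn_gt0// -expR_sum ler_expR -mulr_sumr.
  rewrite ler_wpM2l// -[leLHS]mulr1; apply: le_trans (ler_wpM2l (ltW u0) ge1) _.
  rewrite mulr_sumr; apply: ler_sum => j _.
  by rewrite minr_pMr ?(ltW u0)// divff// gt_eqF.
apply: ler_prod => j _; rewrite mulr_ge0 ?expR_ge0 ?exprn_ge0//=.
case: (lP j) => _ lj0 lj1.
(* Below the level a coordinate costs nothing and the chord bound applies; above it the cost is at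
   most [4 * (b j / 2 ^- s.+1) = 8 * 2 ^+ s * b j]. *)
have [bw|bw] := leP (b j) (2 ^- s.+1).
  rewrite lj0// expr0 mulr1.
  have ub : 0 <= 2 ^+ s * b j by rewrite mulr_ge0// ltW.
  have z01 : 0 <= Num.min (2 ^+ s * b j) 1 <= 1.
    by rewrite le_min ub ler01 ge_min lexx orbT.
  apply: le_trans (expR_chord _ z01) _.
  rewrite lerD2l; apply: (@le_trans _ _ (2 ^+ s * b j * expR h)).
    rewrite ler_pM ?(andP z01).1 ?ge_min ?lexx//; last by lra.
    by rewrite subr_ge0 -expR0 ler_expR.
  have := mulr_ge0 ub (expR_ge0 h); lra.
apply: (@le_trans _ _ (expR h * (4 * (b j / 2 ^- s.+1)))).
  rewrite ler_pM ?expR_ge0 ?exprn_ge0 ?lj1// ler_expR -[leRHS]mulr1 ler_wpM2l//.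
  by rewrite ge_min lexx orbT.
rewrite invrK exprS; lra.
Qed.

(** * Rademacher sums *)

(** For [|x| >= 1/2] one has [|x| <= 2 * x ^+ 2]. Otherwise [expR x <= (1 - x)^-1] and
    [expR (- x) <= (1 + x)^-1], with sum [2 / (1 - x ^+ 2) <= 2 * (1 + 2 * x ^+ 2)]. *)
Lemma cosh_le_expR (R : realType) (x : R) :
  expR x + expR (- x) <= 2 * expR (2 * x ^+ 2).
Proof.
wlog x0 : x / 0 <= x => [wh|].
  have [/wh//|/ltW x0] := leP 0 x.
  by have := wh (- x); rewrite opprK sqrrN addrC oppr_ge0; apply.
have [x1|x1] := leP (2^-1) x.
  have : expR x <= expR (2 * x ^+ 2).
    by rewrite ler_expR expr2 mulrA ler_peMl//; lra.
  have : expR (- x) <= expR x by rewrite ler_expR; lra.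
  lra.
have px : expR x <= (1 - x)^-1.
  rewrite -[x in leLHS]opprK expRN lef_pV2 ?posrE ?expR_gt0 ?subr_gt0//; try lra.
  exact: expR_ge1Dx.
have nx : expR (- x) <= (1 + x)^-1.
  by rewrite expRN lef_pV2 ?posrE ?expR_gt0 ?expR_ge1Dx//; lra.
apply: le_trans (lerD px nx) _.
have -> : (1 - x)^-1 + (1 + x)^-1 = 2 * (1 - x ^+ 2)^-1.
  field; apply/and3P; split; apply: lt0r_neq0; try lra.
  by have : x * x < 2^-1 * 2^-1; rewrite ?expr2; [apply: ltr_pM|]; lra.
rewrite ler_pM2l//; apply: le_trans (expR_ge1Dx _).
have xx : x ^+ 2 <= 4^-1 by rewrite expr2; nra.
rewrite -[leRHS]mul1r -ler_pdivrMr; last by have := sqr_ge0 x; lra.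
rewrite -invfM -[leRHS]invr1 lef_pV2 ?posrE//; last first.
  by apply: mulr_gt0; have := sqr_ge0 x; lra.
have := sqr_ge0 x; nra.
Qed.

Section Rademacher.
Variables (R : realType) (J : finType).
Implicit Types (s : {ffun J -> bool}) (b : J -> R).

Definition flip_sign (j : J) s := [ffun i => if i == j then ~~ s i else s i].

Lemma flip_signK j : involutive (flip_sign j).
Proof.
by move=> s; apply/ffunP => i; rewrite !ffunE; case: eqP => // _; rewrite negbK.
Qed.

(* Averaging over one sign at a time keeps the shape exp (c y^2), at the cost of
   replacing 1/c by something at least 1/c - 8 b_j^2. *)
Lemma rademacher_expR_sqr (b : J -> R) (c K : R) : 0 <= c -> 0 < K ->
  c * (8 * (\sum_j b j ^+ 2) + K) <= 1 ->
  \sum_(s : {ffun J -> bool}) expR (c * (\sum_j (-1) ^+ s j * b j) ^+ 2)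
    <= 2 ^+ #|J| * expR ((\sum_j b j ^+ 2) / K).
Proof.
move=> + K0.
have := index_enum_uniq J; elim: (index_enum J) c => [|j r IH] c /=.
  move=> _ _ _; under eq_bigr do rewrite big_nil expr0n mulr0 expR0.
  rewrite big_nil mul0r expR0 mulr1 sumr_const card_ffun card_bool.
  by rewrite natrX.
case/andP => jr ur c0; rewrite big_cons => cK.
set V := \sum_(i <- r) b i ^+ 2 in cK *.
have V0 : 0 <= V by apply: sumr_ge0 => i _; exact: sqr_ge0.
have b0 := sqr_ge0 (b j).
set q := 8 * V + K in cK *.
have cq : c * q <= 1.
  apply: le_trans cK; rewrite ler_wpM2l// /q; lra.
(* The average over the sign of [e] of the cross term [2 * c * e * y] in the exponent is at most
   [expR (8 * c ^+ 2 * b j ^+ 2 * y ^+ 2)]; together with [c * y ^+ 2] this gives the rate [c']. *)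
pose c' := c * (1 + 8 * c * b j ^+ 2).
have cb : 0 <= 8 * c * b j ^+ 2 by rewrite mulr_ge0// mulr_ge0.
have c'0 : 0 <= c' by rewrite mulr_ge0// addr_ge0.
have c'K : c' * (8 * V + K) <= 1.
  have : 8 * c * b j ^+ 2 * (c * q) <= 8 * c * b j ^+ 2.
    by rewrite ler_piMr.
  rewrite /c' -/q; rewrite /q in cq cK *; lra.
pose Y (s : {ffun J -> bool}) := \sum_(i <- r) (-1) ^+ s i * b i.
have Yflip s : Y (flip_sign j s) = Y s.
  apply: eq_big_seq => i ir; rewrite ffunE; case: eqP => // ij.
  by rewrite -ij ir in jr.
under eq_bigr do rewrite big_cons -/(Y _).
pose f (s : {ffun J -> bool}) := expR (c * ((-1) ^+ s j * b j + Y s) ^+ 2).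
(* Of two copies of the sum, the second is reindexed by flipping the sign [j], which pairs each sign
   with its opposite. *)
rewrite -(ler_pM2l (_ : 0 < 2 :> R))// mulr_natl mulr2n.
rewrite {2}(reindex_inj (inv_inj (flip_signK j))) -big_split/=.
apply: (@le_trans _ _ (\sum_(s : {ffun J -> bool}) 2 * expR (c * b j ^+ 2) * expR (c' * Y s ^+ 2))).
  apply: ler_sum => s _; rewrite Yflip ffunE eqxx.
  set e := (-1) ^+ s j * b j.
  have -> : (-1) ^+ (~~ s j) * b j = - e by rewrite signrN mulNr.
  have e2 : e ^+ 2 = b j ^+ 2 by rewrite exprMn sqrr_sign mul1r.
  clearbody e; move: (Y s) => y.
  have -> : c * (e + y) ^+ 2 = c * e ^+ 2 + c * y ^+ 2 + 2 * c * e * y by ring.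
  have -> : c * (- e + y) ^+ 2 = c * e ^+ 2 + c * y ^+ 2 - 2 * c * e * y by ring.
  rewrite 2!(expRD (_ + _)) -mulrDr.
  apply: le_trans (ler_wpM2l (expR_ge0 _) (cosh_le_expR _)) _.
  rewrite [leLHS]mulrCA -[leRHS]mulrA ler_pM2l// -!expRD ler_expR /c' -e2.
  by rewrite le_eqVlt; apply/orP; left; apply/eqP; ring.
rewrite -mulr_sumr [_ / K]mulrDl expRD -[leLHS]mulrA ler_pM2l// [leRHS]mulrCA.
apply: ler_pM; rewrite ?expR_ge0 ?sumr_ge0//.
- rewrite ler_expR mulrC ler_wpM2l// -[K^-1]mul1r ler_pdivlMr//.
  by apply: le_trans cq; rewrite ler_wpM2l// /q; lra.
- exact: IH.
Qed.

End Rademacher.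

(** * The norm and the vertices of the cube *)

Definition excess (R : realType) (tau y : R) : R := Num.max (y ^+ 2 - tau) 0.

Lemma excess_ge0 (R : realType) (tau y : R) : 0 <= excess tau y.
Proof. by rewrite le_max lexx orbT. Qed.

(* The sum of the excesses replaces the maximum over the k-subsets of
   coordinates: unlike the rearrangement, it is a sum over the rows. *)
Lemma norm_k2_le_excess (R : realType) (N k : nat) (tau gamma rho : R)
    (a y : 'cV[R]_N) : (k <= N)%N -> 0 <= gamma -> a = gamma *: y ->
  \sum_i excess tau (y i 0) <= rho ->
  norm_k2 k a <= gamma * Num.sqrt (k%:R * tau + rho).
Proof.
move=> kN g0 -> yrho.
rewrite -{2}(ger0_norm g0) -sqrtr_sqr -sqrtrM ?sqr_ge0//; apply: ler_wsqrtr.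
set s := rearrangement _.
have sizes : size s = N by rewrite size_sort size_map -cardE card_ord.
pose g (x : R) := Num.max (x ^+ 2 - gamma ^+ 2 * tau) 0.
have g0' x : 0 <= g x by rewrite le_max lexx orbT.
(* Each of the [k] largest squares is at most the level plus its excess; extending the excesses to
   all entries then removes the dependence on the order. *)
apply: (@le_trans _ _ (\sum_(i < k) (gamma ^+ 2 * tau + g s`_i))).
  by apply: ler_sum => i _; rewrite -lerBlDl le_max lexx.
rewrite big_split/= sumr_const card_ord [leRHS]mulrDr [X in _ <= X + _]mulrCA mulr_natl lerD2l.
apply: le_trans (ler_wpM2l (sqr_ge0 gamma) yrho).
apply: (@le_trans _ _ (\sum_(x <- s) g x)).
  rewrite (big_nth 0) sizes big_mkord (big_ord_widen _ (fun i => g s`_i) kN).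
  rewrite [leRHS](bigID (fun i : 'I_N => (i < k)%N))/= lerDl.
  by apply: sumr_ge0 => i _; exact: g0'.
rewrite /s /rearrangement (perm_big _ (permEl (perm_sort _ _)))/= big_image/=.
rewrite mulr_sumr; apply: ler_sum => i _.
rewrite /g /excess !mxE real_normK ?num_real// exprMn -mulrBr.
by rewrite maxr_pMr ?sqr_ge0// mulr0.
Qed.

(** [a + b * x] is the mean of [a + b] and [a - b] with weights [(1 + x) / 2] and [(1 - x) / 2], and
    the positive part of a convex function is convex. *)
Lemma excess_convex (R : realType) (tau a b x : R) : `|x| <= 1 ->
  excess tau (a + b * x) <=
    (1 + x) / 2 * excess tau (a + b) + (1 - x) / 2 * excess tau (a - b).
Proof.
rewrite ler_norml => /andP[x0 x1].
have p0 : 0 <= (1 + x) / 2 by lra.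
have q0 : 0 <= (1 - x) / 2 by lra.
have le1 y : y ^+ 2 - tau <= excess tau y by rewrite le_max lexx.
rewrite {1}/excess ge_max; apply/andP; split; last first.
  by rewrite addr_ge0// mulr_ge0// excess_ge0.
apply: le_trans (lerD (ler_wpM2l p0 (le1 _)) (ler_wpM2l q0 (le1 _))).
have : b ^+ 2 * x ^+ 2 <= b ^+ 2.
  by rewrite ler_piMr ?sqr_ge0// expr2; nra.
lra.
Qed.

(** The coordinates are rounded to signs one after the other; a rounded coordinate still has
    absolute value 1, so the hypothesis applies to the next one. *)
Lemma le_cube_vertex (R : realType) (J : finType) (f : (J -> R) -> R) :
  (forall t j, `|t j| <= 1 ->
     exists b : bool, f t <= f (fun i => if i == j then (-1) ^+ b else t i)) ->
  forall t : J -> R, (forall j, `|t j| <= 1) ->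
  exists v : {ffun J -> bool}, f t <= f (fun i => (-1) ^+ v i).
Proof.
move=> cvx t t1.
suff [v fv] : exists v : J -> bool,
    f t <= f (fun i => if i \in enum J then (-1) ^+ v i else t i).
  exists (finfun v); apply: le_trans fv _; rewrite le_eqVlt; apply/orP; left.
  by apply/eqP; congr f; apply/funext => i; rewrite mem_enum ffunE.
elim: (enum J) => [|j r [v IH]].
  by exists (fun=> false).
have [|b fb] := cvx (fun i => if i \in r then (-1) ^+ v i else t i) j.
  by case: ifP => // _; rewrite normrX normrN1 expr1n.
exists (fun i => if i == j then b else v i).
apply: le_trans IH (le_trans fb _); rewrite le_eqVlt; apply/orP; left.
apply/eqP; congr f; apply/funext => i; rewrite in_cons.
by case: eqP.
Qed.

(** Convexity in each coordinate puts the maximum over the cube at a vertex, so a union bound over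
    the sign vectors controls the whole cube. *)
Lemma sum_excess_vertex (R : realType) (N n : nat) (tau : R) (A : 'I_N -> 'I_n -> R)
    (t : 'I_n -> R) : (forall j, `|t j| <= 1) ->
  exists v : {ffun 'I_n -> bool},
    \sum_i excess tau (\sum_j A i j * t j) <=
    \sum_i excess tau (\sum_j A i j * (-1) ^+ v j).
Proof.
apply: (@le_cube_vertex _ _ (fun t => \sum_i excess tau (\sum_j A i j * t j))).
move=> {}t j tj.
pose S (x : R) := \sum_i excess tau
  (\sum_l A i l * (if l == j then x else t l)).
have SE x : S x = \sum_i excess tau (\sum_(l | l != j) A i l * t l + A i j * x).
  apply: eq_bigr => i _; congr excess.
  rewrite (bigD1 j)//= eqxx addrC; congr (_ + _).
  by apply: eq_bigr => l /negbTE ->.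
have St : \sum_i excess tau (\sum_l A i l * t l) = S (t j).
  by apply: eq_bigr => i _; congr excess; apply: eq_bigr => l _; case: eqP => [->|].
have : S (t j) <= (1 + t j) / 2 * S 1 + (1 - t j) / 2 * S (-1).
  rewrite !SE !mulr_sumr -big_split/=; apply: ler_sum => i _.
  by rewrite mulr1 mulrN1; exact: excess_convex.
move: tj; rewrite ler_norml => /andP[t0 t1].
rewrite St => SS.
have [S1|/ltW S1] := leP (S (-1)) (S 1).
  by exists false; rewrite expr0 -/(S 1); nra.
by exists true; rewrite expr1 -/(S (-1)); nra.
Qed.

(* With c = 1/(16 S) the mean of exp (c Y_i^2) is at most exp (1/8) in each row,
   and c times the truncation level is Lam, so the mean of
   exp (c * sum of the excesses) is at most exp (N exp (1 - Lam)) <= exp k. *)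
Lemma rademacher_excess (R : realType) (N n k : nat) (S Lam : R)
    (b : 'I_N -> 'I_n -> R) :
  0 < S -> (forall i, \sum_j b i j ^+ 2 <= S) ->
  1 <= Lam -> N%:R * expR (1 - Lam) <= k%:R ->
  \sum_(s : {ffun 'I_N -> {ffun 'I_n -> bool}})
     (48 * S * (k%:R * Lam)
        < \sum_i excess (16 * S * Lam) (\sum_j (-1) ^+ s i j * b i j))%R%:R
    <= (2 ^+ n) ^+ N * expR (- (2 * (k%:R * Lam))).
Proof.
move=> S0 bS Lam1 Nk.
pose c := (16 * S)^-1.
have c0 : 0 < c by rewrite invr_gt0 mulr_gt0.
have cS : c * (16 * S) = 1 by rewrite mulVf// mulf_neq0// gt_eqF.
pose Y (s : {ffun 'I_n -> bool}) i := \sum_j (-1) ^+ s j * b i j.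
(* [h] bounds the exponential of the positive part of [u = c * Y s i ^+ 2 - Lam] by [1 + expR u];
   here [c * (16 * S * Lam) = Lam]. *)
pose h s i : R := 1 + expR (- Lam) * expR (c * Y s i ^+ 2).
have h0 s i : 0 <= h s i by rewrite addr_ge0// mulr_ge0 ?expR_ge0.
have hE s i : expR (c * excess (16 * S * Lam) (Y s i)) <= h s i.
  rewrite /excess maxr_pMr ?(ltW c0)// mulr0 mulrBr [c * (_ * Lam)]mulrA cS mul1r.
  have p := mulr_ge0 (expR_ge0 (- Lam)) (expR_ge0 (c * Y s i ^+ 2)).
  rewrite maxEle; case: ifP => _; first by rewrite expR0 lerDl.
  by rewrite expRD mulrC lerDr.
have hsum i : \sum_s h s i <= 2 ^+ n * expR (expR (- Lam) * expR 1).
  rewrite big_split/= sumr_const card_ffun card_bool card_ord -mulr_sumr.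
  apply: (@le_trans _ _ (2 ^+ n + expR (- Lam) * (2 ^+ n * expR 1))).
    rewrite natrX lerD2l ler_wpM2l ?expR_ge0//.
    have K0 : 0 < 8 * S by rewrite mulr_gt0.
    have := @rademacher_expR_sqr R 'I_n (b i) c _ (ltW c0) K0.
    rewrite card_ord => /(_ _)/le_trans; apply.
      by rewrite -[leRHS]cS ler_wpM2l ?(ltW c0)//; have := bS i; lra.
    rewrite ler_wpM2l ?exprn_ge0// ler_expR ler_pdivrMr// mul1r.
    have := bS i; lra.
  rewrite mulrCA -[X in X + _]mulr1 -mulrDr ler_wpM2l ?exprn_ge0//.
  exact: expR_ge1Dx.
(* Exponential Markov bound: [c] times the threshold is [3 * (k * Lam)]. The signs of different rows
   vary freely, so the sum of products factors. *)
apply: (@le_trans _ _ (\sum_(s : {ffun 'I_N -> {ffun 'I_n -> bool}})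
    expR (- (3 * (k%:R * Lam))) * \prod_i h (s i) i)).
  apply: ler_sum => s _; rewrite -/(Y _ _).
  have [lt|_] := ltP; last by rewrite mulr_ge0 ?expR_ge0 ?prodr_ge0.
  apply: (@le_trans _ _ (expR (- (3 * (k%:R * Lam))) *
      \prod_i expR (c * excess (16 * S * Lam) (Y (s i) i)))); last first.
    rewrite ler_wpM2l ?expR_ge0//; apply: ler_prod => i _.
    by rewrite expR_ge0/= hE.
  rewrite -expR_sum -expRD -[leLHS]expR0 ler_expR addrC subr_ge0 -mulr_sumr.
  have -> : 3 * (k%:R * Lam) = c * (48 * S * (k%:R * Lam)).
    have -> : c * (48 * S * (k%:R * Lam)) = c * (16 * S) * (3 * (k%:R * Lam)) by ring.
    by rewrite cS mul1r.
  by rewrite ler_wpM2l ?(ltW c0)// ltW.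
rewrite -mulr_sumr -(bigA_distr_bigA (fun i s => h s i))/=.
apply: (@le_trans _ _ (expR (- (3 * (k%:R * Lam))) *
   \prod_(i < N) (2 ^+ n * expR (expR (- Lam) * expR 1)))).
  rewrite ler_wpM2l ?expR_ge0//; apply: ler_prod => i _.
  by rewrite sumr_ge0//= hsum.
rewrite prodr_const card_ord exprMn mulrCA ler_wpM2l ?exprn_ge0//.
rewrite -expRM_natl -!expRD ler_expR [- Lam + 1]addrC.
(* This uses up one of the three copies of [k * Lam]. *)
have : N%:R * expR (1 - Lam) <= k%:R * Lam.
  by apply: le_trans Nk _; rewrite ler_peMr.
lra.
Qed.

(** * Expectations of products *)

Section ProductFormula.
Local Open Scope ereal_scope.
Context d (T : measurableType d) (R : realType) (P : probability T R).

Import HBNNSimple.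

Lemma measurable_mfun_preimage (X : {mfun T >-> R}) (B : set R) :
  measurable B -> measurable (X @^-1` B).
Proof.
by move=> mB; rewrite -[X in measurable X]setTI; exact: measurable_funP.
Qed.

(** [ZB] is the case of an indicator; linearity extends it to the simple functions that increase to
    [h], and monotone convergence to [h] itself. *)
Lemma ge0_integral_mul_comp (Z : T -> R) (X : {mfun T >-> R}) (c : \bar R) :
  measurable_fun setT Z -> (forall w, (0 <= Z w)%R) -> c \is a fin_num ->
  (forall B, measurable B ->
     \int[P]_w (Z w * \1_B (X w))%:E = c * P (X @^-1` B)) ->
  forall h : R -> R, measurable_fun setT h -> (forall x, (0 <= h x)%R) ->
  \int[P]_w (Z w * h (X w))%:E = c * \int[P]_w (h (X w))%:E.
Proof.
move=> mZ Z0 cfin ZB h mh h0.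
have /measurable_EFinP mEh := mh.
pose f_ := nnsfun_approx measurableT mEh.
have mf n : measurable_fun setT (fun w => f_ n (X w)).
  exact: measurableT_comp.
have ndf w : nondecreasing_seq (fun n => f_ n (X w)).
  by move=> m n mn; exact/lefP/nd_nnsfun_approx.
have cvgf w : (f_ n (X w))%:E @[n --> \oo] --> (h (X w))%:E.
  by apply: (@cvg_nnsfun_approx _ _ _ _ _ _ mEh) => // x _ /=; rewrite lee_fin.
have fE n : \int[P]_w (Z w * f_ n (X w))%:E = c * \int[P]_w (f_ n (X w))%:E.
  have mk k : measurable_fun setT (fun w => \1_(f_ n @^-1` [set k]) (X w) : R).
    exact: measurableT_comp.
  have mZk k : measurable_fun setT
      (fun w => Z w * \1_(f_ n @^-1` [set k]) (X w) : R)%R.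
    exact: measurable_funM.
  under eq_integral do rewrite (fimfunE (f_ n)).
  under [in RHS]eq_integral do rewrite (fimfunE (f_ n)) -fsumEFin//.
  rewrite ge0_integral_fsum//; last 2 first.
  - by move=> y; apply/measurable_EFinP/measurable_funM.
  - by move=> y x _; rewrite nnfun_muleindic_ge0.
  transitivity (\int[P]_w \sum_(k \in range (f_ n))
      (k * (Z w * \1_(f_ n @^-1` [set k]) (X w)))%:E).
    apply: eq_integral => w _; rewrite fsumEFin//; congr EFin.
    rewrite fsbig_finite//= mulr_sumr fsbig_finite//=.
    by apply: eq_bigr => k _; rewrite mulrCA.
  rewrite ge0_integral_fsum//; last 2 first.
  - by move=> y; apply/measurable_EFinP/measurable_funM.
  - move=> y x _; rewrite mulrCA EFinM mule_ge0 ?lee_fin//.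
    exact: nnfun_muleindic_ge0.
  rewrite ge0_mule_fsumr; last first.
    by move=> k; apply: integral_ge0 => x _; exact: nnfun_muleindic_ge0.
  apply: eq_fsbigr => k; rewrite inE => -[x _ kx].
  have k0 : (0 <= k)%R by rewrite -kx.
  under eq_integral do rewrite EFinM.
  under [in RHS]eq_integral do rewrite EFinM.
  rewrite ge0_integralZl_EFin//; last 2 first.
  - by move=> w _; rewrite lee_fin mulr_ge0.
  - exact/measurable_EFinP.
  rewrite ge0_integralZl_EFin//; last exact/measurable_EFinP.
  rewrite ZB// muleCA; congr (_ * (_ * _)).
  by rewrite -[X in P X]setIT -[LHS]integral_indic ?setIT//; exact: measurable_mfun_preimage.
transitivity (limn (fun n => \int[P]_w (Z w * f_ n (X w))%:E)).
  rewrite -monotone_convergence//.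
  - apply: eq_integral => w _; apply/esym/cvg_lim => //.
    under eq_fun do rewrite EFinM.
    by rewrite EFinM; apply: cvgeZl.
  - by move=> n; exact/measurable_EFinP/measurable_funM.
  - by move=> n w _; rewrite lee_fin mulr_ge0.
  - by move=> w _ m n mn; rewrite lee_fin ler_wpM2l// ndf.
under eq_fun do rewrite fE.
have -> : \int[P]_w (h (X w))%:E = limn (fun n => \int[P]_w (f_ n (X w))%:E).
  rewrite -monotone_convergence//.
  - by apply: eq_integral => w _; apply/esym/cvg_lim => //; exact: cvgf.
  - by move=> n; exact/measurable_EFinP.
  - by move=> n w _; rewrite lee_fin.
  - by move=> w _ m n mn; rewrite lee_fin ndf.
apply: limeMl => //; apply: ereal_nondecreasing_is_cvgn => m n mn.
apply: ge0_le_integral => //; [|exact/measurable_EFinP..|].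
- by move=> w _; rewrite lee_fin.
- by move=> w _; rewrite lee_fin ndf.
Qed.

Lemma integral_indic_comp (X : {mfun T >-> R}) (B : set R) : measurable B ->
  \int[P]_w (\1_B (X w))%:E = P (X @^-1` B).
Proof.
move=> mB; rewrite -[X in P X]setIT -[RHS]integral_indic ?setIT//.
exact: measurable_mfun_preimage.
Qed.

(* The factors are replaced one at a time, starting from indicators. *)
Lemma integral_prod_independent (I : finType) (X : I -> {RV P >-> R})
    (h : I -> R -> R) :
  independent_rvs P (fun i => X i : T -> R) ->
  (forall i, measurable_fun setT (h i)) -> (forall i x, (0 <= h i x)%R) ->
  (forall i, \int[P]_w (h i (X i w))%:E < +oo) ->
  \int[P]_w (\prod_i h i (X i w))%:E = \prod_i \int[P]_w (h i (X i w))%:E.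
Proof.
move=> indep.
suff main (r : seq I) (g : I -> R -> R) :
    (forall i, i \notin r -> exists2 B, measurable B & g i = \1_B) ->
    (forall i, measurable_fun setT (g i)) -> (forall i x, (0 <= g i x)%R) ->
    (forall i, \int[P]_w (g i (X i w))%:E < +oo) ->
    \int[P]_w (\prod_i g i (X i w))%:E = \prod_i \int[P]_w (g i (X i w))%:E.
  by apply: (main (enum I)) => i; rewrite mem_enum.
(* [r] lists the factors that may be arbitrary, the others being indicators. For empty [r] the
   product is the indicator of an intersection, and independence applies. *)
elim: r g => [|j r IH] g gr mg g0 goo.
  have /choice[B BP] i : exists B, measurable B /\ g i = \1_B.
    by have [//|B mB gB] := gr i; exists B.
  have gB i : g i = \1_(B i) by case: (BP i).
  have mB i : measurable (B i) by case: (BP i).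
  under eq_bigr do rewrite gB integral_indic_comp//.
  have := indep [set: I]%SET B (fun i _ => mB i).
  under [X in _ = X]eq_bigl do rewrite inE.
  move=> <-; rewrite -[X in P X]setIT -integral_indic//; last first.
    apply: fin_bigcap_measurable => // i _.
    exact: measurable_mfun_preimage.
  apply: eq_integral => w _; congr EFin.
  under eq_bigr do rewrite gB indicE.
  rewrite indicE; have [/set_mem wB|wB] := boolP (w \in _).
    by apply: big1 => i _; rewrite mem_set//; apply: wB; rewrite /= inE.
  have /existsNP[i wBi] : ~ forall i, B i (X i w).
    by move=> wBi; move/negP: wB; apply; apply/mem_set => i _; exact: wBi.
  by rewrite (bigD1 i)//= memNset// mul0r.
pose c := \prod_(i | i != j) \int[P]_w (g i (X i w))%:E.
have int0 i : 0 <= \int[P]_w (g i (X i w))%:E.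
  by apply: integral_ge0 => w _; rewrite lee_fin.
have cfin : c \is a fin_num.
  apply: prode_fin_num => i _.
  by rewrite ge0_fin_numE.
rewrite [RHS](bigD1 j)//= -/c muleC.
under eq_integral do rewrite (bigD1 j)//= mulrC.
apply: ge0_integral_mul_comp => //.
- under eq_fun do rewrite -big_filter.
  by apply: measurable_prod => i _; exact: measurableT_comp.
- by move=> w; apply: prodr_ge0 => i _.
(* With the factor [j] replaced by an indicator, the induction hypothesis gives the identity that is
   required for indicators. *)
move=> B mB; pose g' i := if i == j then \1_B else g i.
have := IH g'; rewrite (bigD1 j)//= muleC.
under eq_integral do rewrite (bigD1 j)//= mulrC.
have g'j : g' j = \1_B by rewrite /g' eqxx.
have g'n i : i != j -> g' i = g i by rewrite /g' => /negbTE ->.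
under eq_bigr => i ij do rewrite g'n//.
under eq_integral.
  move=> w _; under eq_bigr => i ij do rewrite g'n//.
  rewrite g'j; over.
rewrite g'j integral_indic_comp//; apply.
- move=> i ir; have [->|ij] := eqVneq i j; first by exists B.
  by rewrite g'n//; apply: gr; rewrite in_cons negb_or ij.
- by move=> i; have [->|ij] := eqVneq i j; rewrite ?g'j// g'n.
- move=> i x; have [->|ij] := eqVneq i j; rewrite ?g'j// ?g'n//.
- move=> i; have [->|ij] := eqVneq i j; last by rewrite g'n.
  rewrite g'j integral_indic_comp//; apply: le_lt_trans (ltry 1%R).
  by apply: probability_le1; exact: measurable_mfun_preimage.
Qed.

End ProductFormula.

(** * Expected cost of scaling all rows *)

Lemma expR1_le4 (R : realType) : expR 1 <= 4 :> R.
Proof.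
have e2 : expR (2^-1) <= 2 :> R.
  rewrite -[2 in leRHS]invrK -[2^-1 in leLHS]opprK expRN.
  rewrite lef_pV2 ?posrE ?expR_gt0 ?invr_gt0//.
  by apply: le_trans (expR_ge1Dx _); lra.
have -> : expR 1 = expR 2^-1 ^+ 2 :> R by rewrite -expRM_natl divff.
apply: (@le_trans _ _ (2 ^+ 2)); first by rewrite lerXn2r ?nnegrE ?expR_ge0.
by rewrite -natrX.
Qed.

(** Put [q = expR (1 - h)]. As [(1 + 2 ^+ s / n) ^+ n <= expR (2 ^+ s)], the [s]-th term is at most
    [q ^+ (2 ^ s)], hence at most [q * 2 ^- s] because [q <= 1/2] and [2 ^ s - 1 >= s]; the rest is
    a geometric sum. *)
Lemma sum_expR_doubling (R : realType) (n : nat) (h : R) : (0 < n)%N ->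
  expR (1 - h) <= 2^-1 ->
  \sum_(s < n) expR (- (h * 2 ^+ s)) * (1 + 2 ^+ s / n%:R) ^+ n
    <= 2 * expR (1 - h).
Proof.
move=> n0; set q := expR (1 - h) => q2.
have q0 : 0 <= q by exact: expR_ge0.
apply: (@le_trans _ _ (\sum_(s < n) q * 2 ^- s)).
  apply: ler_sum => s _.
  have n0' : 0 < n%:R :> R by rewrite ltr0n.
  have : (1 + 2 ^+ s / n%:R) ^+ n <= expR (2 ^+ s) :> R.
    rewrite -[X in expR X](divfK (lt0r_neq0 n0')) expRM_natr.
    by rewrite lerXn2r ?nnegrE ?expR_ge0 ?expR_ge1Dx.
  move=> /(ler_wpM2l (expR_ge0 (- (h * 2 ^+ s))))/le_trans; apply.
  rewrite -expRD (_ : - (h * 2 ^+ s) + 2 ^+ s = (2 ^ s)%:R * (1 - h)); last first.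
    by rewrite natrX; ring.
  rewrite expRM_natl -/q -exprVn -(prednK (expn_gt0 2 s)) exprS ler_wpM2l//.
  apply: (@le_trans _ _ (2^-1 ^+ (2 ^ s).-1)).
    by rewrite lerXn2r ?nnegrE.
  rewrite ler_wiXn2l//; first by rewrite invr_le1 ?unitfE//; lra.
  by rewrite -ltnS prednK ?expn_gt0// ltn_expl.
rewrite -mulr_sumr mulrC ler_wpM2r//.
suff -> : \sum_(s < n) 2 ^- s = 2 * (1 - 2 ^- n) :> R.
  by rewrite ler_piMr// gerBl invr_ge0 exprn_ge0.
elim: n {n0} => [|n IH]; first by rewrite big_ord0 expr0 invr1 subrr mulr0.
rewrite big_ord_recr/= IH exprS invfM; field.
by rewrite expf_neq0.
Qed.

Section RowScaling.
Context d (T : measurableType d) (R : realType) (P : probability T R).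
Variables (N n : nat) (delta : R) (xi : 'I_N -> 'I_n -> {RV P >-> R}).
Hypotheses (n0 : (0 < n)%N) (delta01 : 0 < delta <= 1).
Hypothesis xi_indep :
  independent_rvs P (fun ij : 'I_N * 'I_n => xi ij.1 ij.2 : T -> R).
Hypothesis xi2 : forall i j, ('E_P[fun w => (xi i j w ^+ 2)%R] = 1)%E.

(** Chosen for two effects: with squares divided by [256 * n / delta], the coefficient
    [8 * expR h * 2 ^+ s] becomes [2 ^+ s / n]; and [2 * expR (1 - h) <= delta / 4]. *)
Let h : R := ln (32 / delta).

Let delta0 : 0 < delta. Proof. by case/andP: delta01. Qed.

Let expRh : expR h = 32 / delta.
Proof. by rewrite lnK// posrE divr_gt0. Qed.

Let h0 : 0 <= h.
Proof. by have [_ d1] := andP delta01; apply: ln_ge0; rewrite ler_pdivlMr//; lra. Qed.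

(** Index 0 stands for the constant term 1 of [row_scaling] and index [s.+1] for its [s]-th term, so
    that a product over the rows expands into a sum over maps from rows to indices. *)
Let coef (s : nat) : R := if s is s'.+1 then expR (- (h * 2 ^+ s')) else 1.
Let rate (s : nat) : R := if s is s'.+1 then 2 ^+ s' else 0.

Let coef_ge0 s : 0 <= coef s.
Proof. by case: s => //= s; rewrite expR_ge0. Qed.

Let rate_ge0 s : 0 <= rate s.
Proof. by case: s => //= s; rewrite exprn_ge0. Qed.

Let sum_coef : \sum_(s < n.+1) coef s * (1 + rate s / n%:R) ^+ n <= expR (delta / 4).
Proof.
rewrite big_ord_recl/= mul0r addr0 expr1n mul1r.
apply: le_trans (expR_ge1Dx _); rewrite lerD2l.
have e4 := expR1_le4 R; have [_ d1] := andP delta01.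
have ed : expR 1 * delta <= 4 * delta by rewrite ler_pM2r.
have qE : expR (1 - h) = expR 1 * (delta / 32).
  by rewrite expRB expRh invf_div.
apply: le_trans (sum_expR_doubling n0 _) _; rewrite qE; lra.
Qed.

Let row (s : nat) (i : 'I_N) (w : T) : R :=
  \prod_j (1 + rate s * (xi i j w ^+ 2 / n%:R)).

Let row_ge0 s i w : 0 <= row s i w.
Proof.
by apply: prodr_ge0 => j _; rewrite addr_ge0// mulr_ge0// divr_ge0// sqr_ge0.
Qed.

Let measurable_factor (c : R) :
  measurable_fun setT (fun x : R => 1 + c * (x ^+ 2 / n%:R)).
Proof.
apply: measurable_funD => //; apply: measurable_funM => //.
by apply: measurable_funM => //; exact: exprn_measurable.
Qed.

Let integral_factor (c : R) i j : 0 <= c ->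
  (\int[P]_w (1 + c * (xi i j w ^+ 2 / n%:R))%:E = (1 + c / n%:R)%:E)%E.
Proof.
move=> c0.
have m2 : measurable_fun setT (fun w => (xi i j w ^+ 2)%:E).
  by apply/measurable_EFinP; exact: measurable_funX.
transitivity (\int[P]_w (1%:E + (c / n%:R)%:E * (xi i j w ^+ 2)%:E))%E.
  by apply: eq_integral => w _; rewrite -EFinM -EFinD; congr EFin; ring.
rewrite ge0_integralD//; last 2 first.
- by move=> w _; rewrite -EFinM lee_fin mulr_ge0 ?divr_ge0// sqr_ge0.
- exact: measurable_funeM.
rewrite integral_cst// [X in (_ * X + _)%E](_ : _ = 1%E); last exact: probability_setT.
rewrite mule1 ge0_integralZl_EFin//; last 2 first.
- by move=> w _; rewrite lee_fin sqr_ge0.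
- by rewrite divr_ge0.
by move: (xi2 i j); rewrite unlock => ->; rewrite mule1.
Qed.

Let integral_rows (s : 'I_N -> nat) :
  (\int[P]_w (\prod_i row (s i) i w)%:E
     = (\prod_i (1 + rate (s i) / n%:R) ^+ n)%:E)%E.
Proof.
transitivity (\int[P]_w (\prod_(p : 'I_N * 'I_n)
    (1 + rate (s p.1) * (xi p.1 p.2 w ^+ 2 / n%:R)))%:E)%E.
  by apply: eq_integral => w _; rewrite pair_bigA.
have E p : (\int[P]_w (1 + rate (s p.1) * (xi p.1 p.2 w ^+ 2 / n%:R))%:E
    = (1 + rate (s p.1) / n%:R)%:E)%E by exact: integral_factor.
rewrite (integral_prod_independent (X := fun p => xi p.1 p.2)
  (h := fun p x => 1 + rate (s p.1) * (x ^+ 2 / n%:R)))//.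
- rewrite (eq_bigr _ (fun p _ => E p)) prodEFin -(pair_bigA _ (fun i _ => 1 + rate (s i) / n%:R))/=.
  by congr EFin; apply: eq_bigr => i _; rewrite prodr_const card_ord.
- by move=> p x; rewrite addr_ge0// mulr_ge0// divr_ge0// sqr_ge0.
- by move=> p; rewrite E ltry.
Qed.

(* Concatenating the row scalings gives an admissible vector of levels unless
   its total cost is too large, and the cost is bounded in expectation. *)
Lemma probability_no_scaling (B : set T) : measurable B ->
  (forall w, B w -> forall l : 'I_n -> nat,
     (forall i, \sum_j xi i j w ^+ 2 / 16 ^+ l j <= 256 * n%:R / delta) ->
     expR (delta * N%:R / 2) < 4 ^+ (\sum_j l j)) ->
  (P B <= (expR (- (delta * N%:R / 4)))%:E)%E.
Proof.
move=> mB Bl.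
pose c (s : {ffun 'I_N -> 'I_n.+1}) := expR (- (delta * N%:R / 2)) * \prod_i coef (s i).
have c0 s : 0 <= c s by rewrite mulr_ge0 ?expR_ge0 ?prodr_ge0.
pose Z s w := c s * \prod_i row (s i) i w.
have Z0 s w : 0 <= Z s w by rewrite mulr_ge0 ?prodr_ge0.
have mrow s i : measurable_fun setT (row s i).
  apply: measurable_prod => j _.
  exact: (measurableT_comp (measurable_factor (rate s))).
have mrows (s : {ffun 'I_N -> 'I_n.+1}) :
    measurable_fun setT (fun w => \prod_i row (s i) i w).
  by apply: measurable_prod => i _; exact: mrow.
have mZ s : measurable_fun setT (Z s) by exact: measurable_funM.
rewrite -[X in P X]setIT -integral_indic//.
(* Markov: the [Z s] are the terms of the expanded cost bound divided by [expR (delta * N / 2)], so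
   they sum to at least 1 on [B]. *)
apply: (@le_trans _ _ (\int[P]_w (\sum_s Z s w)%:E)%E).
  apply: ge0_le_integral => //.
  - exact/measurable_EFinP.
  - by apply/measurable_EFinP; apply: measurable_sum.
  move=> w _; rewrite lee_fin indicE.
  have [/set_mem Bw|_] := boolP (w \in B); last by rewrite sumr_ge0.
  rewrite -[leLHS](expRxMexpNx_1 (delta * N%:R / 2)) mulrC.
  rewrite /Z /c; under eq_bigr do rewrite -mulrA -big_split/=.
  rewrite -mulr_sumr -(bigA_distr_bigA (fun i (s : 'I_n.+1) => coef s * row s i w))/=.
  rewrite ler_wpM2l ?expR_ge0//.
  pose a := 256 * n%:R / delta.
  have a0 : 0 < a by rewrite divr_gt0// mulr_gt0// ltr0n.
  have /choice[l lP] i := @row_scaling R h n (fun j => xi i j w ^+ 2 / a) h0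
    (fun j => divr_ge0 (sqr_ge0 _) (ltW a0)).
  (* The levels of all rows are added up: each row keeps its bound, since larger levels only shrink
     the entries, and the costs multiply. *)
  apply: (@le_trans _ _ (4 ^+ (\sum_j \sum_i l i j))).
    apply/ltW/(Bl w Bw) => i; have [+ _] := lP i => /(ler_wpM2l (ltW a0)).
    rewrite mulr1 mulr_sumr; apply: le_trans; apply: ler_sum => j _.
    rewrite -mulrA mulrCA mulVKf ?gt_eqF// ler_wpM2l ?sqr_ge0//.
    rewrite lef_pV2 ?posrE ?exprn_gt0// ler_weXn2l//; first by lra.
    by rewrite (bigD1 i)//= leq_addr.
  rewrite exchange_big/= -prodrXr; apply: ler_prod => i _.
  rewrite exprn_ge0//=; have [_] := lP i; move=> /le_trans; apply.
  rewrite big_ord_recl /= mul1r lerD//.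
    by rewrite /row big1// => j _; rewrite mul0r addr0.
  apply: ler_sum => s _; rewrite ler_wpM2l ?expR_ge0// /row le_eqVlt.
  apply/orP; left; apply/eqP; apply: eq_bigr => j _; rewrite expRh /a/=.
  by field; rewrite !gt_eqF// ltr0n.
have mE s : measurable_fun setT (fun w => (Z s w)%:E) by exact/measurable_EFinP.
under eq_integral do rewrite -sumEFin.
rewrite ge0_integral_sum//; last by move=> s w _; rewrite lee_fin.
have ZE s : (\int[P]_w (Z s w)%:E =
    (c s * \prod_i (1 + rate (s i) / n%:R) ^+ n)%:E)%E.
  under eq_integral do rewrite EFinM.
  rewrite ge0_integralZl_EFin//; last 2 first.
  - by move=> w _; rewrite lee_fin prodr_ge0.
  - exact/measurable_EFinP.
  by rewrite integral_rows.
rewrite (eq_bigr _ (fun s _ => ZE s)) sumEFin lee_fin /c.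
under eq_bigr do rewrite -mulrA -big_split/=.
rewrite -mulr_sumr.
rewrite -(bigA_distr_bigA (fun (i : 'I_N) (s : 'I_n.+1) => coef s * (1 + rate s / n%:R) ^+ n)).
apply: (@le_trans _ _ (expR (- (delta * N%:R / 2)) * \prod_(i < N) expR (delta / 4))).
  rewrite ler_wpM2l ?expR_ge0//; apply: ler_prod => i _.
  rewrite sum_coef andbT sumr_ge0// => s _.
  by rewrite mulr_ge0// exprn_ge0// addr_ge0// divr_ge0.
rewrite prodr_const card_ord -expRM_natl -expRD ler_expR; lra.
Qed.
End RowScaling.

(** * Symmetrization *)

(** Generators of the product sigma-algebra on [I -> R]. They are stable under intersection, so a
    probability law is determined by its values on them. *)
Definition boxes (R : realType) (I : finType) : set (set (I -> R)) :=
  [set [set a : I -> R | forall i, B i (a i)]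
    | B in [set B : I -> set R | forall i, measurable (B i)]].

Section Symmetrization.
Context d (T : measurableType d) (R : realType) (P : probability T R).
Variable I : finType.

Let space := g_sigma_algebraType (@boxes R I).

Lemma measurable_coordinate (i : I) :
  measurable_fun setT (fun a : space => a i).
Proof.
move=> _ B mB; rewrite setTI; apply: sub_sigma_algebra.
exists (fun j => if j == i then B else setT).
  by move=> j; case: eqP.
apply/seteqP; split=> a /=; first by move/(_ i); rewrite eqxx.
by move=> Ba j; case: eqP => [->|].
Qed.

Lemma measurable_to_boxes (Y : T -> space) :
  (forall i, measurable_fun setT (fun w => Y w i)) -> measurable_fun setT Y.
Proof.
move=> mY; apply: (@measurability _ _ T space setT Y (@boxes R I)) => //.
move=> _ [_ [B mB <-] <-]; rewrite setTI.
rewrite (_ : _ @^-1` _ = \bigcap_(i in [set: I]) ((fun w => Y w i) @^-1` B i)).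
  apply: fin_bigcap_measurable => // i _.
  by rewrite -[X in measurable X]setTI; exact: mY.
by apply/seteqP; split=> w /= Bw i => [_|]; exact: Bw.
Qed.

Variable X : I -> {RV P >-> R}.
Hypothesis X_indep : independent_rvs P (fun i => X i : T -> R).
Hypothesis X_sym : forall i, symmetric_rv P (X i).

Definition sign_rv (s : I -> bool) (w : T) : space :=
  fun i => (-1) ^+ s i * X i w.

Lemma measurable_sign_rv s : measurable_fun setT (sign_rv s).
Proof.
by apply: measurable_to_boxes => i; apply: measurable_funM.
Qed.

(** On a box independence gives the product of the marginals, and symmetry makes each marginal blind
    to its sign; boxes determine the law. *)
Lemma sign_rv_law (s s' : I -> bool) (A : set space) : measurable A ->
  P (sign_rv s @^-1` A) = P (sign_rv s' @^-1` A).
Proof.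
suff main r : forall A : set space, measurable A ->
    P (sign_rv r @^-1` A) = P (sign_rv (fun=> false) @^-1` A).
  by move=> mA; rewrite main// [RHS]main.
move=> {}A mA.
pose f s0 : {mfun T >-> space} :=
  HB.pack (sign_rv s0) (isMeasurableFun.Build _ _ _ _ _ (measurable_sign_rv s0)).
have boxE s0 (B : I -> set R) : (forall i, measurable (B i)) ->
    P (sign_rv s0 @^-1` [set a | forall i, B i (a i)])
    = (\prod_i P (X i @^-1` B i))%E.
  move=> mB.
  pose B' i := (fun x => (-1) ^+ s0 i * x) @^-1` B i.
  have mB' i : measurable (B' i).
    rewrite -[X in measurable X]setTI.
    suff : measurable_fun setT (fun x : R => (-1) ^+ s0 i * x) by apply.
    exact: measurable_funM.
  have := @X_indep [set: I]%SET B' (fun i _ => mB' i).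
  under eq_bigl do rewrite inE.
  have -> : \bigcap_(i in [set` [set: I]%SET]) (X i @^-1` B' i)
      = sign_rv s0 @^-1` [set a | forall i, B i (a i)].
    apply/seteqP; split=> w /=; first by move=> Bw i; apply: Bw; rewrite /= inE.
    by move=> Bw i _; exact: Bw.
  move=> ->; apply: eq_bigr => i _.
  rewrite /B'; case: (s0 i); last first.
    by congr (P _); apply/seteqP; split => w /=; rewrite mul1r.
  rewrite (X_sym i (mB i)).
  by congr (P _); apply/seteqP; split => w /=; rewrite mulN1r.
apply: (@measure_unique _ R space (@boxes R I) (fun=> setT) _ _ _ _
  (distribution P (f r)) (distribution P (f (fun=> false)))) => //.
- move=> _ _ [B mB <-] [C mC <-]; exists (fun i => B i `&` C i).
    by move=> i; exact: measurableI.
  apply/seteqP; split => a /=; first by move=> BC; split=> i; case: (BC i).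
  by case=> Ba Ca i.
- by move=> _; exists (fun=> setT) => //; apply/seteqP; split.
- by rewrite bigcup_const.
- by move=> _ [B mB <-]; exact: etrans (boxE r B mB) (esym (boxE _ B mB)).
- by move=> _; apply: le_lt_trans (ltry 1%R); exact: probability_le1.
Qed.

(** All signed copies have the same law, so [#|K|] times the probability is the expected number of
    sign patterns that lead into [H], which is bounded pointwise. This takes the place of
    conditioning on the absolute values. *)
Lemma symmetrization (K : finType) (s : K -> I -> bool) (H : set space)
    (beta : R) : measurable H -> (0 < #|K|)%N ->
  (forall a, \sum_k \1_H (fun i => (-1) ^+ s k i * a i) <= beta * #|K|%:R) ->
  (P [set w | H (fun i => X i w)] <= beta%:E)%E.
Proof.
move=> mH K0 bound.
have K0' : 0 < #|K|%:R :> R by rewrite ltr0n.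
have mpre r : measurable (sign_rv r @^-1` H).
  by rewrite -[X in measurable X]setTI; exact: measurable_sign_rv.
rewrite (_ : [set w | _] = sign_rv (fun=> false) @^-1` H); last first.
  apply/funext => w; congr H.
  by apply/funext => i; rewrite /sign_rv mul1r.
rewrite -(@lee_pmul2l _ #|K|%:R%:E) ?lte_fin//.
apply: (@le_trans _ _ (\sum_(k : K) P (sign_rv (s k) @^-1` H))%E).
  rewrite (eq_bigr (fun=> P (sign_rv (fun=> false) @^-1` H))); last first.
    by move=> k _; exact: sign_rv_law.
  by rewrite sumr_const mule_natl.
apply: (@le_trans _ _ (\int[P]_w
  (\sum_(k : K) \1_(sign_rv (s k) @^-1` H) w)%:E)%E).
  under eq_integral do rewrite -sumEFin.
  rewrite ge0_integral_sum//; last first.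
    by move=> k; exact/measurable_EFinP/measurable_indic/mpre.
  by apply: lee_sum => k _; rewrite integral_indic ?setIT.
rewrite -EFinM -[leRHS]mule1 -(@probability_setT _ _ _ P) -integral_cst//.
apply: ge0_le_integral => //.
- by move=> w _; rewrite lee_fin sumr_ge0.
- apply/measurable_EFinP; apply: measurable_sum => k.
  exact/measurable_indic/mpre.
by move=> w _; rewrite lee_fin mulrC; exact: bound.
Qed.

End Symmetrization.

(** * The good event and its probability *)

Lemma measurable_le_cst d (T : measurableType d) (R : realType) (f : T -> R)
    (c : R) : measurable_fun setT f -> measurable [set x | f x <= c].
Proof.
move=> mf; rewrite -[X in measurable X]setTI (_ : [set x | _] = f @^-1` `]-oo, c]).
  by apply: mf => //; exact: measurable_itv.
by apply/seteqP; split => x /=; rewrite in_itv.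
Qed.

Lemma measurable_excess (R : realType) (tau : R) :
  measurable_fun setT (excess tau).
Proof.
apply: measurable_funTS; apply: measurable_maxr => //.
by apply: measurable_funB => //; exact: exprn_measurable.
Qed.

(** Since [m < 4 ^ m], levels of bounded cost are bounded, which makes the relevant level vectors a
    finite type. *)
Lemma level_lt_bound (R : realType) (n : nat) (c : R) (l : 'I_n -> nat) j :
  4 ^+ (\sum_j l j) <= c -> (l j < Num.bound c)%N.
Proof.
move=> lc; rewrite -(ltr_nat R).
apply: le_lt_trans (archi_boundP (le_trans (exprn_ge0 _ _) lc)) => //.
apply: le_trans lc; rewrite -natrX ler_nat; apply: (@leq_trans (\sum_j l j)%N).
  by rewrite (bigD1 j)//= leq_addr.
exact/ltnW/ltn_expl.
Qed.

Section GoodEvent.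
Context d (T : measurableType d) (R : realType) (P : probability T R).
Variables (N n k : nat) (delta : R) (xi : 'I_N -> 'I_n -> {RV P >-> R}).
Hypotheses (n0 : (0 < n)%N) (k0 : (0 < k)%N) (kN : (k <= N)%N).
Hypothesis delta01 : 0 < delta <= 1.
Hypothesis xi_indep :
  independent_rvs P (fun ij : 'I_N * 'I_n => xi ij.1 ij.2 : T -> R).
Hypothesis xi_sym : forall i j, symmetric_rv P (xi i j).
Hypothesis xi2 : forall i j, ('E_P[fun w => (xi i j w ^+ 2)%R] = 1)%E.

Let Lam : R := ln (expR 1 * N%:R / k%:R).
Hypothesis nk : n%:R <= k%:R * Lam.

Let S : R := 256 * n%:R / delta.

Let space := g_sigma_algebraType (@boxes R ('I_N * 'I_n)%type).

Let N0 : 0 < N%:R :> R. Proof. by rewrite ltr0n (leq_trans k0). Qed.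
Let kR0 : 0 < k%:R :> R. Proof. by rewrite ltr0n. Qed.
Let S0 : 0 < S.
Proof. by rewrite divr_gt0 ?mulr_gt0 ?ltr0n//; case/andP: delta01. Qed.

Let expLam : expR Lam = expR 1 * N%:R / k%:R.
Proof. by rewrite lnK// posrE divr_gt0// mulr_gt0// expR_gt0. Qed.

Let Lam1 : 1 <= Lam.
Proof.
by rewrite -ler_expR expLam -mulrA ler_peMr ?expR_ge0// ler_pdivlMr// mul1r ler_nat.
Qed.

Let size_bound := Num.bound (expR (delta * N%:R / 2)).
Let level := {ffun 'I_n -> 'I_size_bound}.

Let cheap : {set level} :=
  [set l : level | 4 ^+ (\sum_j l j) <= expR (delta * N%:R / 2)]%SET.

Let admissible (l : level) : set space :=
  [set a | forall i, \sum_j a (i, j) ^+ 2 / 16 ^+ l j <= S].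

Let rows_excess (l : level) (v : {ffun 'I_n -> bool}) (a : space) : R :=
  \sum_i excess (16 * S * Lam) (\sum_j a (i, j) / 4 ^+ l j * (-1) ^+ v j).

(** Only sign vectors are tested: the condition is finite, hence measurable, and convexity extends
    it to the cube. *)
Let tame (l : level) : set space :=
  [set a | forall v, rows_excess l v a <= 48 * S * (k%:R * Lam)].

Let measurable_admissible l : measurable (admissible l).
Proof.
rewrite (_ : admissible l = \bigcap_(i in [set: 'I_N])
    [set a : space | \sum_j a (i, j) ^+ 2 / 16 ^+ l j <= S]); last first.
  by apply/seteqP; split => a /= al i => [_|]; exact: al.
apply: fin_bigcap_measurable => // i _; apply: measurable_le_cst.
apply: measurable_sum => j; apply: measurable_funM => //.
apply: measurable_funX; exact: measurable_coordinate.
Qed.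

Let measurable_tame l : measurable (tame l).
Proof.
rewrite (_ : tame l = \bigcap_(v in [set: {ffun 'I_n -> bool}])
    [set a | rows_excess l v a <= 48 * S * (k%:R * Lam)]); last first.
  by apply/seteqP; split => a /= al v => [_|]; exact: al.
apply: fin_bigcap_measurable => // v _; apply: measurable_le_cst.
apply: measurable_sum => i; apply: measurableT_comp; first exact: measurable_excess.
apply: measurable_sum => j; apply: measurable_funM => //.
by apply: measurable_funM => //; exact: measurable_coordinate.
Qed.

Let cover : set space := \bigcup_(l in [set` cheap]) admissible l.
Let good : set space := \bigcup_(l in [set` cheap]) (admissible l `&` tame l).

Let measurable_cover : measurable cover.
Proof. by apply: fin_bigcup_measurable. Qed.

Let measurable_good : measurable good.
Proof. by apply: fin_bigcup_measurable => // l _; exact: measurableI. Qed.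

Let entries (w : T) : space := fun ij => xi ij.1 ij.2 w.

Let measurable_entries A : measurable A -> measurable (entries @^-1` A).
Proof.
move=> mA; rewrite -[X in measurable X]setTI.
suff : measurable_fun setT entries by apply.
exact: measurable_to_boxes.
Qed.

Let probability_not_cover :
  (P (entries @^-1` (~` cover)) <= (expR (- (delta * N%:R / 4)))%:E)%E.
Proof.
apply: (probability_no_scaling n0 delta01 xi_indep xi2).
  by apply: measurable_entries; exact: measurableC.
move=> w wcover l ladm; rewrite ltNge; apply/negP => l4; apply: wcover.
exists [ffun j => Ordinal (level_lt_bound j l4)].
  by rewrite /= inE; under eq_bigr do rewrite ffunE.
by move=> i; under eq_bigr do rewrite ffunE; exact: ladm.
Qed.

(* The set [cover] is invariant under sign changes; once an admissible l is
   fixed, the random signs make it tame with high conditional probability. *)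
Let probability_cover_not_good :
  (P (entries @^-1` (cover `\` good)) <= (expR (- (k%:R * Lam)))%:E)%E.
Proof.
apply: (@symmetrization _ _ _ P _ (fun ij => xi ij.1 ij.2) xi_indep _
  {ffun 'I_N -> {ffun 'I_n -> bool}} (fun s ij => s ij.1 ij.2)).
- by move=> ij; exact: xi_sym.
- exact: measurableD.
- by rewrite card_ffun card_ffun card_bool !expn_gt0.
move=> a.
have cardE : #|{ffun 'I_N -> {ffun 'I_n -> bool}}|%:R = (2 ^+ n) ^+ N :> R.
  by rewrite card_ffun card_ffun card_bool !card_ord !natrX.
rewrite cardE.
(* The squares of [sa s] are those of [a]: either no sign change of [a] lies in [cover], or one [l]
   is admissible for all of them. *)
pose sa (s : {ffun 'I_N -> {ffun 'I_n -> bool}}) : space :=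
  fun ij => (-1) ^+ s ij.1 ij.2 * a ij.
have [[l lcheap la]|nla] := pselect (exists2 l, l \in cheap & admissible l a); last first.
  rewrite big1 ?mulr_ge0 ?expR_ge0 ?exprn_ge0// => s _.
  rewrite indicE memNset// => -[[l lcheap lsa] _]; apply: nla.
  exists l => // i; have := lsa i; congr (_ <= _).
  by apply: eq_bigr => j _; rewrite exprMn sqrr_sign mul1r.
(* Outside [good] this [l] is not tame, so some [v] fails: union bound over [v]. *)
apply: (@le_trans _ _ (\sum_s \sum_(v : {ffun 'I_n -> bool})
    (48 * S * (k%:R * Lam) < rows_excess l v (sa s))%R%:R)).
  apply: ler_sum => s _; rewrite indicE.
  have [/set_mem[_ nsa]|_] := boolP (_ \in _); last by rewrite sumr_ge0.
  have /existsNP[v /negP] : ~ tame l (sa s).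
    move=> tl; apply: nsa; exists l => //; split => // i.
    have := la i; congr (_ <= _).
    by apply: eq_bigr => j _; rewrite exprMn sqrr_sign mul1r.
  rewrite -ltNge => vlt.
  by rewrite (bigD1 v)//= vlt lerDl sumr_ge0.
rewrite exchange_big/=.
apply: (@le_trans _ _ (\sum_(v : {ffun 'I_n -> bool})
   (2 ^+ n) ^+ N * expR (- (2 * (k%:R * Lam))))).
  apply: ler_sum => v _.
  (* The fixed signs [v] are absorbed into the coefficients without changing their squares. *)
  pose b i j := a (i, j) / 4 ^+ l j * (-1) ^+ v j.
  have bS i : \sum_j b i j ^+ 2 <= S.
    apply: le_trans (la i); apply: ler_sum => j _.
    rewrite exprMn sqrr_sign mulr1 exprMn exprVn -exprM mulnC exprM.
    by rewrite (_ : 4 ^+ 2 = 16)// -natrX.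
  have Nk : N%:R * expR (1 - Lam) <= k%:R.
    rewrite expRB expLam le_eqVlt; apply/orP; left; apply/eqP.
    by field; rewrite !gt_eqF// expR_gt0.
  apply: le_trans (rademacher_excess S0 bS Lam1 Nk).
  apply: ler_sum => s _; rewrite /rows_excess /sa /b /=.
  set x := (X in (_ < X)%R); set y := (X in _ <= (_ < X)%R%:R).
  rewrite (_ : x = y)//; apply: eq_bigr => i _; congr excess.
  by apply: eq_bigr => j _; rewrite -!mulrA.
rewrite sumr_const card_ffun card_bool card_ord -[leLHS]mulr_natl natrX mulrCA.
rewrite [leRHS]mulrC ler_wpM2l ?exprn_ge0//.
(* By [nk], [2 ^ n <= expR n <= expR (k * Lam)]: the union bound costs one of the two copies of
   [k * Lam]. *)
apply: (@le_trans _ _ (expR (k%:R * Lam) * expR (- (2 * (k%:R * Lam))))).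
  rewrite ler_wpM2r ?expR_ge0//.
  apply: (@le_trans _ _ (expR n%:R)); last by rewrite ler_expR.
  rewrite -[n%:R]mulr1 expRM_natl lerXn2r ?nnegrE ?expR_ge0//.
  by apply: le_trans (expR_ge1Dx _); lra.
rewrite -expRD ler_expR; lra.
Qed.

Lemma exists_good_event : exists E : set T, [/\ measurable E,
  ((1 - expR (- (k%:R * Lam)) - expR (- (delta * N%:R / 4)))%:E <= P E)%E
  & forall w, E w -> exists l : 'I_n -> nat,
     4 ^+ (\sum_j l j) <= expR (delta * N%:R / 2) :> R /\
     forall t : 'I_n -> R, (forall j, `|t j| <= 1) ->
       \sum_i excess (16 * S * Lam) (\sum_j xi i j w / 4 ^+ l j * t j)
         <= 48 * S * (k%:R * Lam)].
Proof.
exists (entries @^-1` good); split.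
- exact: measurable_entries.
- rewrite (_ : _ @^-1` _ = ~` (entries @^-1` (~` good))); last first.
    by apply/seteqP; split => w /=; [move=> gw|exact: contrapT].
  rewrite probability_setC; last first.
    by apply: measurable_entries; exact: measurableC.
  rewrite !EFinB -addeA -oppeD//; apply: leeB => //.
  (* The two failures, no cheap admissible level and none that is also tame, give the two
     exponential terms. *)
  rewrite (_ : ~` good = (cover `\` good) `|` ~` cover); last first.
    apply/seteqP; split=> a /=; last first.
      case=> [[]//|nc [l lc [la _]]]; apply: nc; exists l => //.
    by move=> ng; have [ca|nca] := pselect (cover a); [left|right].
  rewrite preimage_setU; apply: le_trans (measureU2 P _ _) _.
  - by apply: measurable_entries; exact: measurableD.
  - by apply: measurable_entries; exact: measurableC.
  exact: leeD.
- move=> w [l lcheap [_ lt]]; exists (fun j => nat_of_ord (l j)); split.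
    by move: lcheap; rewrite /= inE.
  move=> t t1; have [v] := @sum_excess_vertex R N n (16 * S * Lam)
    (fun i j => xi i j w / 4 ^+ l j) t t1.
  by move=> /le_trans; apply; exact: lt.
Qed.

End GoodEvent.

(** * Counting levels and boxes *)

(** With [m] the sum of the levels, [m <= D / 2] because 4 exceeds e, so [4 ^+ m <= expR (D / 2) *
    expR (y * (D / 2 - m))]. Summing over all [l] then factors into [n] geometric series; [y]
    remains to be chosen. *)
Lemma sum_cheap_levels (R : realType) (n K : nat) (D y : R) : 0 < y ->
  \sum_(l : {ffun 'I_n -> 'I_K} | 4 ^+ (\sum_j l j) <= expR (D / 2))
     4 ^+ (\sum_j l j)
  <= expR ((1 + y) * (D / 2)) * (1 - expR (- y)) ^- n.
Proof.
move=> y0; set x := expR (- y).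
have x0 : 0 <= x by exact: expR_ge0.
have x1 : 0 < 1 - x by rewrite subr_gt0 expR_lt1 oppr_lt0.
apply: (@le_trans _ _ (\sum_(l : {ffun 'I_n -> 'I_K})
    expR ((1 + y) * (D / 2)) * \prod_j x ^+ l j)).
  rewrite [leRHS](bigID (fun l : {ffun 'I_n -> 'I_K} =>
    4 ^+ (\sum_j l j) <= expR (D / 2)))/=.
  rewrite ler_wpDr ?sumr_ge0//.
    by move=> l _; rewrite mulr_ge0 ?expR_ge0 ?prodr_ge0// => j _; rewrite exprn_ge0.
  apply: ler_sum => l l4; rewrite prodrXr.
  have lD : (\sum_j l j)%:R <= D / 2.
    rewrite -ler_expR; apply: le_trans l4.
    rewrite -[X in expR X]mulr1 expRM_natl lerXn2r ?nnegrE ?expR_ge0//.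
    exact: expR1_le4.
  apply: (le_trans l4); rewrite /x -expRM_natl -expRD ler_expR.
  have := ler_wpM2l (ltW y0) lD; lra.
rewrite -mulr_sumr ler_wpM2l ?expR_ge0//.
rewrite -(bigA_distr_bigA (fun (j : 'I_n) (a : 'I_K) => x ^+ a))/=.
rewrite prodr_const card_ord -exprVn lerXn2r ?nnegrE ?invr_ge0 ?(ltW x1)//.
  by rewrite sumr_ge0// => a _; rewrite exprn_ge0.
rewrite -[leRHS]mul1r ler_pdivlMr// mulrC.
rewrite -opprB mulNr -subrX1 opprB gerBl exprn_ge0//.
Qed.

Lemma sum_cheap_levels_le_F (R : realType) (n N K : nat) (delta : R) :
  (0 < n)%N -> (0 < N)%N -> 0 < delta ->
  \sum_(l : {ffun 'I_n -> 'I_K} | 4 ^+ (\sum_j l j) <= expR (delta * N%:R / 2))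
     4 ^+ (\sum_j l j)
  <= F delta n N * expR (delta * N%:R).
Proof.
move=> n0 N0 d0; have nR0 : 0 < n%:R :> R by rewrite ltr0n.
have NR0 : 0 < N%:R :> R by rewrite ltr0n.
have D0 : 0 < delta * N%:R by rewrite mulr_gt0.
rewrite /F ler_pdivrMr ?mulr_gt0//.
set D := delta * N%:R in D0 *.
have -> : 32 * delta * N%:R = 32 * D by rewrite mulrA.
have -> : 4 * delta * N%:R = 4 * D by rewrite mulrA.
have -> : delta * (2 * N%:R) = 2 * D by rewrite mulrCA.
clearbody D; have [nD|nD] := leP (n%:R : R) (2 * D).
  (* Here [y = 1]: each geometric series is at most 2, while [32 * D / n >= 16]. *)
  apply: le_trans (sum_cheap_levels _ _ _ (@ltr01 R)) _.
  rewrite (_ : (1 + 1) * (D / 2) = D); last by lra.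
  rewrite mulrC ler_wpM2r ?expR_ge0// -exprVn.
  have e2 : 2 <= expR 1 :> R by have := expR_ge1Dx (1 : R); lra.
  have i2 : expR (-1) <= 2^-1 :> R by rewrite expRN lef_pV2 ?posrE ?expR_gt0.
  rewrite lerXn2r ?nnegrE ?invr_ge0 ?divr_ge0//; try lra.
  apply: (@le_trans _ _ 2).
    rewrite -[2]invrK lef_pV2 ?posrE ?invr_gt0//; lra.
  by rewrite ler_pdivlMr//; lra.
have Dn0 : 0 < D / n%:R by rewrite divr_gt0.
have Dn2 : D / n%:R <= 2^-1 by rewrite ler_pdivrMr//; lra.
(* Now [expR (- y) = D / n] is at most 1/2, so the series contribute at most [expR (2 * D)], and
   [expR (1 + y)] is the base of the power in [F]. *)
pose y := - ln (D / n%:R).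
have ye : expR (- y) = D / n%:R by rewrite opprK lnK.
have y0 : 0 < y by rewrite oppr_gt0 ln_lt0// Dn0/=; lra.
apply: le_trans (sum_cheap_levels _ _ _ y0) _.
have -> : expR 1 * n%:R / D = expR (1 + y).
  by rewrite expRD -mulrA -(invf_div D) -ye -expRN opprK.
rewrite -expRM -expRD.
have : (1 - expR (- y)) ^- n <= expR (2 * D).
  rewrite ye (_ : 2 * D = n%:R * (2 * (D / n%:R))); last first.
    by field; rewrite gt_eqF.
  rewrite expRM_natl -exprVn lerXn2r ?nnegrE ?expR_ge0 ?invr_ge0//; first by lra.
  apply: le_trans (expR_ge1Dx _).
  rewrite -[leLHS]mul1r ler_pdivrMr; [nra|lra].
move=> /(ler_wpM2l (expR_ge0 ((1 + y) * (D / 2))))/le_trans; apply.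
rewrite -expRD ler_expR.
have := mulr_gt0 y0 D0; lra.
Qed.

Section Boxes.
Context (R : realType) (n : nat).
Implicit Types (l p : 'I_n -> nat) (a x z u : 'cV[R]_n).

(** The sides [2 * eps / 4 ^+ l j] are such that [4 ^+ (\sum_j l j)] translates tile a cube of side
    [2 * eps]. *)
Definition dyadic_box (eps : R) l a : set 'cV[R]_n :=
  [set a + diag_mx (\row_j (2 * eps / 4 ^+ l j)) *m t
    | t in [set t : 'cV[R]_n | forall i, 0 <= t i 0 <= 1]].

(** Lower corner of the cell of index [p] in the cube of radius [eps] about [x]. *)
Definition grid_point (eps : R) l p x : 'cV[R]_n :=
  x + \col_j (eps * (2 * (p j)%:R / 4 ^+ l j - 1)).

Lemma dyadic_box_parallelepiped (eps : R) l a : 0 < eps ->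
  parallelepiped (dyadic_box eps l a).
Proof.
move=> e0; exists a, (diag_mx (\row_j (2 * eps / 4 ^+ l j))); split=> //.
rewrite unitmxE det_diag unitfE; apply/prodf_neq0 => j _; rewrite mxE.
by rewrite gt_eqF// divr_gt0// mulr_gt0.
Qed.

Lemma dyadic_boxB (eps : R) l a x z : dyadic_box eps l a x ->
  dyadic_box eps l a z -> exists2 t : 'I_n -> R, forall j, `|t j| <= 1 &
    z - x = \col_j (2 * eps * (t j / 4 ^+ l j)).
Proof.
move=> [s s01 <-] [t t01 <-]; exists (fun j => t j 0 - s j 0).
  move=> j; have /andP[s0 s1] := s01 j; have /andP[t0 t1] := t01 j.
  by rewrite ler_norml; lra.
apply/matrixP => j c; rewrite !mxE ord1 (bigD1 j)//= [X in _ + (_ + X)]big1; last first.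
  by move=> i ij; rewrite !mxE eq_sym (negbTE ij) mulr0n mul0r.
rewrite [X in _ - (_ + X)](bigD1 j)//= [X in _ - (_ + (_ + X))]big1; last first.
  by move=> i ij; rewrite !mxE eq_sym (negbTE ij) mulr0n mul0r.
by rewrite !mxE eqxx mulr1n; ring.
Qed.

(** The least [q] with [v <= q.+1] is taken instead of the floor, so that the endpoint [v = m] falls
    into the last cell. *)
Lemma nat_cell (m : nat) (v : R) : (0 < m)%N -> 0 <= v <= m%:R ->
  exists2 q : nat, (q < m)%N & 0 <= v - q%:R <= 1.
Proof.
move=> m0 /andP[v0 vm].
have ex : exists q : nat, v <= q.+1%:R by exists m.-1; rewrite prednK.
case: (ex_minnP ex) => q vq minq; exists q.
  by rewrite -(prednK m0) ltnS minq// prednK.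
apply/andP; split; last by rewrite lerBlDr addrC natr1.
case: q vq minq => [|q] _ minq; first by rewrite subr0.
by rewrite subr_ge0 leNgt; apply/negP => /ltW/minq; rewrite ltnn.
Qed.

Lemma dyadic_box_cover (eps : R) l x u : (forall j, `|u j 0| <= 1) ->
  exists2 p : 'I_n -> nat, forall j, (p j < 4 ^ l j)%N
    & dyadic_box eps l (grid_point eps l p x) (x + eps *: u).
Proof.
move=> u1.
have /choice[p pP] j : exists q : nat, (q < 4 ^ l j)%N /\
    0 <= (4 ^ l j)%:R * ((u j 0 + 1) / 2) - q%:R <= 1.
  have [//||q] := @nat_cell (4 ^ l j) ((4 ^ l j)%:R * ((u j 0 + 1) / 2)).
  - by rewrite expn_gt0.
  - have := u1 j; rewrite ler_norml => /andP[u0 u2].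
    by rewrite mulr_ge0//=; [rewrite ler_piMr//; lra|lra].
  by move=> qm q01; exists q.
exists p => [j|]; first by case: (pP j).
exists (\col_j ((4 ^ l j)%:R * ((u j 0 + 1) / 2) - (p j)%:R)).
  by move=> j; rewrite mxE; case: (pP j).
apply/matrixP => j c; rewrite !mxE ord1 (bigD1 j)//= big1; last first.
  by move=> i ij; rewrite !mxE eq_sym (negbTE ij) mulr0n mul0r.
rewrite !mxE eqxx mulr1n natrX; field.
by rewrite expf_neq0.
Qed.

Lemma norm_k2_image_le (N k : nat) (tau rho s c : R) l (t : 'I_n -> R)
    (G : 'M[R]_(N, n)) : (k <= N)%N -> 0 <= s -> 0 <= c ->
  \sum_i excess tau (\sum_j G i j / 4 ^+ l j * t j) <= rho ->
  norm_k2 k (s *: (G *m \col_j (c * (t j / 4 ^+ l j))))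
    <= s * c * Num.sqrt (k%:R * tau + rho).
Proof.
move=> kN s0 c0 Grho.
apply: (@norm_k2_le_excess R N k tau (s * c) rho _
  (\col_i \sum_j G i j / 4 ^+ l j * t j)) => //; first exact: mulr_ge0.
  apply/matrixP => i d; rewrite !mxE ord1 -mulrA; congr (_ * _).
  by rewrite mulr_sumr; apply: eq_bigr => j _; rewrite !mxE; ring.
by under eq_bigr do rewrite mxE.
Qed.

Lemma Binf_entry u j : Binf u -> `|u j 0| <= 1.
Proof.
apply: le_trans; rewrite [leRHS]mx_normrE.
exact: (le_bigmax _ (fun ij => `|u ij.1 ij.2|) (j, 0)).
Qed.

End Boxes.

(** * From an optimal net to a finite family of boxes *)

Lemma counting_le_size (T : choiceType) (R : realType) (s : seq T) (A : set T) :
  (forall x, A x -> x \in s) -> (counting A <= (size s)%:R%:E :> \bar R)%E.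
Proof.
move=> As; have cardA : (A #<= `I_(size s))%card.
  have [->|/set0P[x0 _]] := eqVneq A set0; first exact: card_ge0.
  apply: card_le_trans (card_image_le (nth x0 s) _); apply: subset_card_le.
  move=> x /As xs; exists (index x s); last exact: nth_index.
  by rewrite /= index_mem.
rewrite /counting asboolT; last exact: card_le_finite cardA (finite_II _).
by rewrite lee_fin ler_nat geq_card_fset_set.
Qed.

(** A finite infimum of cardinalities is attained, by well-ordering of the sizes of finite nets. *)
Lemma exists_minimal_net (R : realType) (m : nat) (L K : set 'cV[R]_m) (eps : R) :
  covering_number L K eps != +oo%E ->
  exists2 s : seq 'cV[R]_m, is_net L K eps [set` s]
    & ((size s)%:R%:E <= covering_number L K eps)%E.
Proof.
rewrite -ltey => Moo.
have netP A : is_net L K eps A -> (counting A < +oo :> \bar R)%E ->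
    exists2 s : seq 'cV[R]_m, is_net L K eps [set` s]
      & (size s)%:R%:E = counting A :> \bar R.
  rewrite /counting; case: asboolP => // finA netA _.
  exists (finmap.enum_fset (fset_set A)) => //.
  by rewrite (_ : [set` _] = A)//; apply: fset_setK.
pose Q j := `[< exists2 s : seq 'cV[R]_m, is_net L K eps [set` s] & size s = j >].
have exQ : exists j, Q j.
  have [_ [A netA <-] Aoo] := ereal_inf_lt Moo.
  by have [s nets _] := netP A netA Aoo; exists (size s); apply/asboolP; exists s.
case: (ex_minnP exQ) => j /asboolP[s nets <-] mins; exists s => //.
apply/ereal_infP => _ [A netA <-].
have [->|] := eqVneq (counting A : \bar R) +oo%E; first by rewrite leey.
rewrite -ltey => Aoo; have [s' nets' <-] := netP A netA Aoo.
by rewrite lee_fin ler_nat; apply: mins; apply/asboolP; exists s'.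
Qed.

(** Pairs of a level vector and a cell index. The bound [4 ^ K] only makes the index type finite;
    the true range depends on the levels. *)
Definition grid (R : realType) (n K : nat) (c : R) :
    {set {ffun 'I_n -> 'I_K} * {ffun 'I_n -> 'I_(4 ^ K)}} :=
  [set lp : {ffun 'I_n -> 'I_K} * {ffun 'I_n -> 'I_(4 ^ K)} |
     (4 ^+ (\sum_j lp.1 j) <= c) &&
            [forall j, (lp.2 j < 4 ^ lp.1 j)%N]]%SET.

Lemma card_grid (R : realType) (n K : nat) (c : R) :
  #|grid n K c|%:R =
    \sum_(l : {ffun 'I_n -> 'I_K} | 4 ^+ (\sum_j l j) <= c) 4 ^+ (\sum_j l j) :> R.
Proof.
transitivity (\sum_(l : {ffun 'I_n -> 'I_K} | 4 ^+ (\sum_j l j) <= c)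
   \sum_(p : {ffun 'I_n -> 'I_(4 ^ K)} | [forall j, (p j < 4 ^ l j)%N]) (1 : R)).
  rewrite pair_big_dep/= -sum1_card natr_sum.
  by apply: eq_bigl => lp; rewrite inE.
apply: eq_bigr => l _.
rewrite -prodrXr; transitivity
   (\prod_j \sum_(q < 4 ^ K | (q < 4 ^ l j)%N) (1 : R)).
  rewrite bigA_distr_big_dep.
  apply: eq_big => [p|p _]; last by rewrite big1.
  by apply/forallP/familyP.
apply: eq_bigr => j _.
rewrite -(big_ord_widen _ (fun=> 1)) ?sumr_const ?card_ord ?natrX//.
by rewrite leq_exp2l// ltnW.
Qed.

Lemma F_gt0 (R : realType) (n N : nat) (delta : R) :
  (0 < n)%N -> (0 < N)%N -> 0 < delta -> 0 < F delta n N.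
Proof.
move=> n0 N0 d0; rewrite /F; case: ifP => _; last first.
  by rewrite powR_gt0// divr_gt0 ?mulr_gt0 ?expR_gt0 ?ltr0n.
by rewrite exprn_gt0// divr_gt0 ?mulr_gt0 ?ltr0n.
Qed.

(* Each cube of an optimal net is cut, for every admissible vector of levels l,
   into the translates of 2 eps D [0,1]^n with D_jj = 4^-l_j that tile it. *)
Lemma exists_net_and_boxes (R : realType) (N n : nat) (delta eps : R)
    (T : set 'cV[R]_n) : (0 < n)%N -> (0 < N)%N -> 0 < delta -> 0 < eps ->
  T !=set0 ->
  exists (Net : set 'cV[R]_n) (Par : set (set 'cV[R]_n)),
    [/\ Net `<=` T, (forall Q, Par Q -> parallelepiped Q),
       (maxe (counting Net) (counting Par)
          <= covering_number T (@Binf R n) eps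
               * (F delta n N * expR (delta * N%:R))%:E)%E
     & forall l : 'I_n -> nat, 4 ^+ (\sum_j l j) <= expR (delta * N%:R / 2) ->
         forall x, T x -> exists a, [/\ Par (dyadic_box eps l a),
           dyadic_box eps l a x & exists2 y, Net y & dyadic_box eps l a y]].
Proof.
move=> n0 N0 d0 e0 [x0 Tx0].
have FE0 : 0 < F delta n N * expR (delta * N%:R).
  by rewrite mulr_gt0 ?expR_gt0// F_gt0.
(* Without a finite net the cardinality bound is vacuous, so all of [T] and all parallelepipeds are
   taken. *)
have [Moo|Moo] := eqVneq (covering_number T (@Binf R n) eps) +oo%E.
  exists T, (@parallelepiped R n); split => //.
    by rewrite Moo gt0_mulye ?lte_fin// leey.
  move=> l _ x Tx.
  have u0 j : `|(0 : 'cV[R]_n) j 0| <= 1 by rewrite mxE normr0.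
  have [p _] := dyadic_box_cover eps l x u0; rewrite scaler0 addr0 => px.
  exists (grid_point eps l p x); split => //; last by exists x.
  exact: dyadic_box_parallelepiped.
have [s [sT Ts] sM] := exists_minimal_net Moo.
set c := expR (delta * N%:R / 2).
pose K := Num.bound c.
pose cell (x : 'cV[R]_n) (lp : {ffun 'I_n -> 'I_K} * {ffun 'I_n -> 'I_(4 ^ K)}) :=
  let l j := nat_of_ord (lp.1 j) in
  dyadic_box eps l (grid_point eps l (fun j => nat_of_ord (lp.2 j)) x).
pose cells := [seq cell x lp | x <- s, lp <- enum (grid n K c)].
(* [f] selects a point of [T] in every box that meets [T], with default [x0]; its values on the
   cells form the net, which therefore lies in [T]. *)
have /choice[f fP] (Q : set 'cV[R]_n) :
    exists y, T y /\ ((exists2 z, T z & Q z) -> Q y).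
  have [[z Tz Qz]|nQ] := pselect (exists2 z, T z & Q z); first by exists z.
  by exists x0; split => // /nQ.
have cellsM : ((size cells)%:R%:E
    <= covering_number T (@Binf R n) eps * (F delta n N * expR (delta * N%:R))%:E)%E.
  rewrite size_allpairs -cardE natrM card_grid EFinM; apply: lee_pmul => //.
  - by rewrite lee_fin sumr_ge0// => l _; rewrite exprn_ge0.
  - by rewrite lee_fin sum_cheap_levels_le_F.
exists [set y | exists2 Q, Q \in cells & y = f Q], [set` cells]; split.
- by move=> _ [Q _ ->]; case: (fP Q).
- by move=> Q /allpairsP[[x lp] [_ _ ->]]; exact: dyadic_box_parallelepiped.
- rewrite ge_max; apply/andP; split; last first.
    by apply: le_trans cellsM; exact: counting_le_size.
  apply: le_trans cellsM; rewrite -(size_map f); apply: counting_le_size.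
  by move=> _ [Q Qcells ->]; exact: map_f.
move=> l lc x Tx; have [z zs [u u1 xE]] := Ts x Tx.
have [p pl px] := dyadic_box_cover eps l z (fun j => Binf_entry j u1).
have lK j : (l j < K)%N by exact: level_lt_bound lc.
have pK j : (p j < 4 ^ K)%N.
  by apply: leq_trans (pl j) _; rewrite leq_exp2l// ltnW.
rewrite xE in px.
have boxcells : dyadic_box eps l (grid_point eps l p z) \in cells.
  apply/allpairsP.
  exists (z, ([ffun j => Ordinal (lK j)], [ffun j => Ordinal (pK j)])).
  split => //=.
    rewrite mem_enum inE /=; apply/andP; split.
      by under eq_bigr do rewrite ffunE.
    by apply/forallP => j; rewrite !ffunE /= pl.
  rewrite /cell /=; congr (dyadic_box _ _ (grid_point _ _ _ _));
    by apply/funext => j; rewrite ffunE.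
exists (grid_point eps l p z); split => //.
exists (f (dyadic_box eps l (grid_point eps l p z))).
  by exists (dyadic_box eps l (grid_point eps l p z)).
by case: (fP (dyadic_box eps l (grid_point eps l p z))) => _; apply; exists x.
Qed.

(** * Combining the deterministic family with the good event *)

Theorem theorem3p1 (R : realType) :
  exists C : R, 1 <= C /\
  forall (N n k : nat) (delta eps : R) (T : set 'cV[R]_n),
    (1 <= N)%N -> (1 <= n <= N)%N ->
    0 < delta <= 1 -> 0 < eps <= 1 ->
    (1 <= k <= N)%N ->
    (n%:R : R) <= k%:R * ln (expR 1 * N%:R / k%:R) ->
    T !=set0 ->
    let M : \bar R := covering_number T (@Binf R n) eps in
    let r : R := C * eps * Num.sqrt (k%:R * n%:R / delta
                                     * ln (expR 1 * N%:R / k%:R)) in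
    exists (Net : set 'cV[R]_n) (Par : set (set 'cV[R]_n)),
      [/\ Net `<=` T,
          (forall Q, Par Q -> parallelepiped Q),
          (maxe (counting Net) (counting Par)
             <= M * (F delta n N * expR (delta * N%:R))%:E)%E &
          forall (d : measure_display) (Omega : measurableType d)
                 (P : probability Omega R)
                 (xi : 'I_N -> 'I_n -> {RV P >-> R}),
            independent_rvs P (fun ij : 'I_N * 'I_n => xi ij.1 ij.2 : Omega -> R) ->
            (forall i j, symmetric_rv P (xi i j)) ->
            (forall i j, ('E_P[fun w => (xi i j w ^+ 2)%R] = 1)%E) ->
            (forall i j j', same_law P (xi i j) (xi i j')) ->
            let Gamma (w : Omega) : 'M[R]_(N, n) :=
              random_matrix (fun i j => xi i j : Omega -> R) w in
            exists E : set Omega,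
              [/\ measurable E,
                  ((1 - expR (- (k%:R * ln (expR 1 * N%:R / k%:R)))
                      - expR (- (delta * N%:R / 4)))%:E <= P E)%E &
                  forall w, E w ->
                    (forall x, T x -> exists y, Net y /\
                       norm_k2 k (Gamma w *m (x - y)) <= r) /\
                    (forall x, T x -> exists Q, [/\ Par Q, Q x &
                       [set Gamma w *m z | z in Q] `<=`
                       [set Gamma w *m x + r *: b | b in @Bk2 R N k]])]].
Proof.
(* 256 is [2 * 128]: the 2 is from the side [2 * eps] of the cubes, and [16 * S + 48 * S = 64 * S]
   with [S = 256 * n / delta] gives [128 ^+ 2]. *)
exists 256; split; first by lra.
move=> N n k delta eps T N0 /andP[n0 nN] delta01 /andP[eps0 _] /andP[k0 kN] nk T0.
move=> M r; have [delta0 _] := andP delta01.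
have [Net [Par [NetT ParP card_le boxP]]] :=
  exists_net_and_boxes n0 N0 delta0 eps0 T0.
exists Net, Par; split => //.
move=> d Omega P xi indep sym var1 _ Gamma.
have [E [mE PE good]] := exists_good_event n0 k0 kN delta01 indep sym var1 nk.
exists E; split => //.
(* The levels [l] depend on [w], but the family, fixed before [Gamma], contains boxes for all cheap
   levels. *)
move=> w /good[l [lc lt]].
set Lam := ln _ in nk r lt *.
have kLam0 : 0 < k%:R * Lam by apply: lt_le_trans nk; rewrite ltr0n.
have rad0 : 0 < k%:R * n%:R / delta * Lam.
  rewrite (_ : _ * Lam = k%:R * Lam * n%:R / delta); last by ring.
  by rewrite divr_gt0// mulr_gt0// ltr0n.
have r0 : 0 < r by rewrite !mulr_gt0// sqrtr_gt0.
set S := 256 * n%:R / delta in lt.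
have rE : 2 * eps * Num.sqrt (k%:R * (16 * S * Lam) + 48 * S * (k%:R * Lam)) = r.
  rewrite (_ : _ + _ = 128 ^+ 2 * (k%:R * n%:R / delta * Lam)); last by rewrite /S; ring.
  rewrite sqrtrM ?sqr_ge0// sqrtr_sqr ger0_norm// /r; ring.
(* Two points of one box have images at distance at most [r]. The factor [s] is 1 for the net and
   [r^-1] for the inclusion in the ball. *)
have key a x z (s : R) : 0 <= s -> dyadic_box eps l a x -> dyadic_box eps l a z ->
    norm_k2 k (s *: (Gamma w *m (z - x))) <= s * r.
  move=> s0 ax az; have [t t1 ->] := dyadic_boxB ax az.
  rewrite -rE mulrA; apply: norm_k2_image_le => //.
    by rewrite mulr_ge0// ltW.
  apply: le_trans (lt t t1); apply: ler_sum => i _.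
  by under eq_bigr do rewrite mxE.
split=> x Tx.
  have [a [_ ax [y Nety ay]]] := boxP l lc x Tx.
  by exists y; split=> //; have := key a y x 1 ler01 ay ax; rewrite scale1r mul1r.
have [a [Para ax _]] := boxP l lc x Tx.
exists (dyadic_box eps l a); split => // _ [z az <-].
exists (r^-1 *: (Gamma w *m (z - x))).
  by have := key a x z r^-1 _ ax az; rewrite mulVf ?gt_eqF//; apply; rewrite invr_ge0 ltW.
by rewrite scalerA divff ?gt_eqF// scale1r mulmxBr addrC subrK.
Qed.
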